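(* Let $R$ be a commutative unital ring and let $\Lambda$ be a finitely aligned $k$-graph such that the sets $\Lambda^0_{\geq v}:=\{w\in\Lambda^0: v\leq w\}$ are finite for all $v\in\Lambda^0$. Then the Kumjian-Pask algebra $\mathrm{KP}_R(\Lambda)$ is purely infinite simple if and only if $R$ is a field, and $\Lambda$ is both cofinal and aperiodic and contains a cycle.
   Context: $\mathbb{N}$ is the set of non-negative integers and $k\ge 1$ is an integer. $\mathbb{N}^k$ carries pointwise addition and the coordinatewise partial order $\le$; $m\vee n$ is the coordinatewise maximum. **$k$-graphs.** A $k$-graph is a countable small category $\Lambda$ with range and source maps $r,s$, together with a functor $d:\Lambda\to\mathbb{N}^k$ such that whenever $d(\lambda)=m+n$ there are unique $\lambda_1,\lambda_2\in\Lambda$ with $d(\lambda_1)=m$, $d(\lambda_2)=n$, $\lambda=\lambda_1\lambda_2$. Objects (vertices) are identified with the paths of degree $0$; their set is $\Lambda^0$. The composite $\lambda\mu$ is defined iff $s(\lambda)=r(\mu)$. Write $v\Lambda=\{\lambda: r(\lambda)=v\}$, and $v\le w$ if there is $\lambda\in\Lambda$ with $r(\lambda)=v$, $s(\lambda)=w$ (i.e. $v\Lambda w\ne\emptyset$). $\mathrm{MCE}(\mu,\nu)$ is the set of paths $\lambda$ with $d(\lambda)=d(\mu)\vee d(\nu)$ and $\lambda=\mu\alpha=\nu\beta$ for some $\alpha,\beta\in\Lambda$, and $\Lambda^{\min}(\mu,\nu)=\{(\alpha,\beta):\mu\alpha=\nu\beta\in\mathrm{MCE}(\mu,\nu)\}$.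 $\Lambda$ is finitely aligned if $\Lambda^{\min}(\mu,\nu)$ is finite (possibly empty) for all $\mu,\nu$. A cycle is a path $\mu$ with $d(\mu)\ne0$ and $s(\mu)=r(\mu)$. **Exhaustive sets.** $E\subseteq v\Lambda$ is exhaustive if for every $\lambda\in v\Lambda$ there is $\mu\in E$ with $\Lambda^{\min}(\lambda,\mu)\neq\emptyset$. $v\mathrm{FE}(\Lambda)$ is the collection of finite exhaustive sets $E\subseteq v\Lambda\setminus\{v\}$. **Boundary paths.** For $m\in(\mathbb{N}\cup\{\infty\})^k$, $\Omega_{k,m}=\{(p,q)\in\mathbb{N}^k\times\mathbb{N}^k: p\le q\le m\}$ is the $k$-graph with $r(p,q)=(p,p)$, $s(p,q)=(q,q)$, $d(p,q)=q-p$. A boundary path is a degree-preserving functor $x:\Omega_{k,m}\to\Lambda$ such that for all $p\in\mathbb{N}^k$, $p\le m$, and all $E\in x(p,p)\mathrm{FE}(\Lambda)$ there is $\mu\in E$ with $p+d(\mu)\le m$ and $x(p,p+d(\mu))=\mu$. Write $d(x)=m$, $x(n)=x(n,n)$, $r(x)=x(0)$; $\partial\Lambda$ is the set of boundary paths and $v\partial\Lambda=\{x\in\partial\Lambda:r(x)=v\}$. For $n\in\mathbb{N}^k$, $n\le d(x)$, the shift $\sigma^n(x)\in\partial\Lambda$ has degree $d(x)-n$ and $\sigma^n(x)(p,q)=x(n+p,n+q)$. **Cofinal, aperiodic.** $\Lambda$ is cofinal if for every $v\in\Lambda^0$ and $x\in\partial\Lambda$ there is $n\le d(x)$, $n\in\mathbb{N}^k$,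 with $v\Lambda x(n)\ne\emptyset$. $\Lambda$ is aperiodic if for every $v\in\Lambda^0$ and $m\ne n\in\mathbb{N}^k$ there is $x\in v\partial\Lambda$ with either $m\vee n\not\le d(x)$ or $\sigma^m(x)\neq\sigma^n(x)$. **Kumjian-Pask algebra.** A Kumjian-Pask $\Lambda$-family in an $R$-algebra is a collection $\{S_\lambda,S_{\lambda^*}:\lambda\in\Lambda\}$ (with $S_{v^*}=S_v$ for $v\in\Lambda^0$) such that: (KP1) $S_vS_w=\delta_{v,w}S_v$ for $v,w\in\Lambda^0$; (KP2) $S_\mu S_\nu=S_{\mu\nu}$ and $S_{\nu^*}S_{\mu^*}=S_{(\mu\nu)^*}$ when $s(\mu)=r(\nu)$; (KP3) $S_{\mu^*}S_\nu=\sum_{(\alpha,\beta)\in\Lambda^{\min}(\mu,\nu)}S_\alpha S_{\beta^*}$ for all $\mu,\nu$; (KP4) $\prod_{\mu\in E}(S_v-S_\mu S_{\mu^*})=0$ for all $v\in\Lambda^0$, $E\in v\mathrm{FE}(\Lambda)$. $\mathrm{KP}_R(\Lambda)$ is the universal $R$-algebra generated by a Kumjian-Pask $\Lambda$-family $\{s_\lambda,s_{\lambda^*}\}$ (not necessarily unital). **Purely infinite.** An idempotent $e$ of a ring $A$ is infinite if $eA$ is isomorphic, as a right $A$-module, to a proper direct summand of itself. $A$ is purely infinite if every nonzero right ideal of $A$ contains an infinite idempotent. Purely infinite simple means purely infinite and simple (simple rings are nonzero). *)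

(* Defs.v *)
From HB Require Import structures.
From mathcomp Require Import all_boot all_order all_algebra.
From mathcomp Require Import finmap generic_quotient.
From mathcomp Require Import boolp classical_sets functions cardinality fsbigop.

Set Implicit Arguments.
Unset Strict Implicit.
Unset Printing Implicit Defensive.

Import GRing.Theory.

Local Open Scope classical_set_scope.
Local Open Scope ring_scope.

(* [N^k]; pointwise addition and [0] are those of the [nmodType] of finite
   functions. *)
Definition deg (k : nat) := {ffun 'I_k -> nat}.

Definition dle k (m n : deg k) : Prop := forall i, (m i <= n i)%N.
Definition dmax k (m n : deg k) : deg k := [ffun i => maxn (m i) (n i)].
Definition dsub k (m n : deg k) : deg k := [ffun i => (m i - n i)%N].

(* [(N \cup {oo})^k], with [None] for [oo]. *)
Definition xdeg (k : nat) := {ffun 'I_k -> option nat}.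

Definition dlex k (p : deg k) (m : xdeg k) : Prop :=
  forall i, if m i is Some b then (p i <= b)%N else true.
Definition xsub k (m : xdeg k) (n : deg k) : xdeg k :=
  [ffun i => omap (fun b => (b - n i)%N) (m i)].

(* [kcomp] is a total function, but only its values on composable pairs
   ([ksrc l = krng m]) are meaningful, and only those are ever used.  Objects
   and paths of degree 0 are matched up by [kid]. *)
Record kgraph (k : nat) := KGraph {
  kvert : countType;
  kpath : countType;
  krng : kpath -> kvert;
  ksrc : kpath -> kvert;
  kid : kvert -> kpath;
  kcomp : kpath -> kpath -> kpath;
  kdeg : kpath -> deg k;
  krng_id : forall v, krng (kid v) = v;
  ksrc_id : forall v, ksrc (kid v) = v;
  krng_comp : forall l m, ksrc l = krng m -> krng (kcomp l m) = krng l;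
  ksrc_comp : forall l m, ksrc l = krng m -> ksrc (kcomp l m) = ksrc m;
  kcomp_idl : forall l, kcomp (kid (krng l)) l = l;
  kcomp_idr : forall l, kcomp l (kid (ksrc l)) = l;
  kcompA : forall l m n, ksrc l = krng m -> ksrc m = krng n ->
    kcomp l (kcomp m n) = kcomp (kcomp l m) n;
  kdeg_id : forall v, kdeg (kid v) = 0;
  kdeg_comp : forall l m, ksrc l = krng m ->
    kdeg (kcomp l m) = kdeg l + kdeg m;
  kfactor : forall l (m n : deg k), kdeg l = m + n ->
    exists! p : kpath * kpath,
      [/\ kdeg p.1 = m, kdeg p.2 = n, ksrc p.1 = krng p.2
        & l = kcomp p.1 p.2]
}.

Arguments kid {k} _ _.

Section KGraphNotions.
Variables (k : nat) (L : kgraph k).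
Implicit Types (v w : kvert L) (l mu nu : kpath L).

Definition vle v w : Prop := exists l, krng l = v /\ ksrc l = w.

Definition MCE mu nu : set (kpath L) :=
  [set l | kdeg l = dmax (kdeg mu) (kdeg nu)
    /\ exists a b, [/\ ksrc mu = krng a, l = kcomp mu a,
                       ksrc nu = krng b & l = kcomp nu b]].

Definition Lmin mu nu : set (kpath L * kpath L) :=
  [set p | [/\ ksrc mu = krng p.1, ksrc nu = krng p.2,
               kcomp mu p.1 = kcomp nu p.2
             & MCE mu nu (kcomp mu p.1)]].

Definition finitely_aligned : Prop := forall mu nu, finite_set (Lmin mu nu).

Definition has_cycle : Prop :=
  exists mu : kpath L, kdeg mu <> 0 /\ ksrc mu = krng mu.

Definition exhaustive v (E : set (kpath L)) : Prop :=
  (forall mu, E mu -> krng mu = v) /\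
  (forall l, krng l = v -> exists mu, E mu /\ Lmin l mu !=set0).

Definition FE v (E : {fset kpath L}) : Prop :=
  exhaustive v [set` E] /\ kid L v \notin E.

(* Data of a functor [Omega_{k,m} -> L]: [xobj x p] is the image of the object
   [p <= m] and [xmor x p q] that of the morphism [(p, q)], [p <= q <= m].
   Values outside these domains are irrelevant, hence [xeq]. *)
Record omap_data := OmapData {
  xd : xdeg k;
  xobj : deg k -> kvert L;
  xmor : deg k -> deg k -> kpath L
}.

Definition xeq (x y : omap_data) : Prop :=
  [/\ xd x = xd y,
      forall p, dlex p (xd x) -> xobj x p = xobj y p
    & forall p q, dle p q -> dlex q (xd x) -> xmor x p q = xmor y p q].

Definition is_degree_functor (x : omap_data) : Prop :=
  [/\ forall p q, dle p q -> dlex q (xd x) ->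
        krng (xmor x p q) = xobj x p /\ ksrc (xmor x p q) = xobj x q,
      forall p, dlex p (xd x) -> xmor x p p = kid L (xobj x p),
      forall p q r, dle p q -> dle q r -> dlex r (xd x) ->
        xmor x p r = kcomp (xmor x p q) (xmor x q r)
    & forall p q, dle p q -> dlex q (xd x) ->
        kdeg (xmor x p q) = dsub q p].

Definition is_boundary_path (x : omap_data) : Prop :=
  is_degree_functor x /\
  forall p, dlex p (xd x) -> forall E, FE (xobj x p) E ->
    exists mu, [/\ mu \in E, dlex (p + kdeg mu) (xd x)
                 & xmor x p (p + kdeg mu) = mu].

Definition xshift (n : deg k) (x : omap_data) : omap_data :=
  OmapData (xsub (xd x) n) (fun p => xobj x (n + p))
           (fun p q => xmor x (n + p) (n + q)).

Definition cofinal : Prop :=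
  forall v x, is_boundary_path x ->
    exists n, dlex n (xd x) /\ vle v (xobj x n).

Definition aperiodic : Prop :=
  forall v (m n : deg k), m <> n ->
    exists x, [/\ is_boundary_path x, xobj x 0 = v
                & ~ dlex (dmax m n) (xd x)
                  \/ ~ xeq (xshift m x) (xshift n x)].

End KGraphNotions.

(* Associative, not necessarily unital, algebras. *)
Record nualg (R : comPzRingType) := NUAlg {
  nucar :> lmodType R;
  numul : nucar -> nucar -> nucar;
  numulA : forall x y z, numul x (numul y z) = numul (numul x y) z;
  numulDl : forall x y z, numul (x + y) z = numul x z + numul y z;
  numulDr : forall x y z, numul x (y + z) = numul x y + numul x z;
  numulZl : forall (a : R) x y, numul (a *: x) y = a *: numul x y;
  numulZr : forall (a : R) x y, numul x (a *: y) = a *: numul x y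
}.

Notation "x ** y" := (numul x y) (at level 40, left associativity).

Definition is_nuhom (R : comPzRingType) (A B : nualg R) (f : A -> B) : Prop :=
  [/\ forall x y, f (x + y) = f x + f y,
      forall (a : R) x, f (a *: x) = a *: f x
    & forall x y, f (x ** y) = f x ** f y].

Section KPFamily.
Variables (R : comPzRingType) (k : nat) (L : kgraph k) (A : nualg R).

(* [S l] is S_l and [G l] is S_{l^*}.  In (KP4) the seed [S (kid L v)] of the
   product makes sense of it in a non-unital algebra; by (KP1) and (KP2) it is
   a unit for every factor, and [E], being exhaustive, is nonempty. *)
Record is_KP_family (S G : kpath L -> A) : Prop := IsKPFamily {
  KP_ghost_id : forall v, G (kid L v) = S (kid L v);
  KP1 : forall v w,
    S (kid L v) ** S (kid L w) = if v == w then S (kid L v) else 0;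
  KP2 : forall mu nu, ksrc mu = krng nu ->
    S mu ** S nu = S (kcomp mu nu) /\ G nu ** G mu = G (kcomp mu nu);
  KP3 : forall mu nu,
    G mu ** S nu = \sum_(p \in Lmin mu nu) (S p.1 ** G p.2);
  KP4 : forall v (E : {fset kpath L}), FE v E ->
    \big[@numul R A / S (kid L v)]_(mu <- E)
      (S (kid L v) - S mu ** G mu) = 0
}.

End KPFamily.

(* The Kumjian-Pask algebra: formal expressions in the generators, modulo
   equality of their values in all Kumjian-Pask families.  Its universal
   property is [KP_universal] below. *)
Section KumjianPask.
Variables (R : comPzRingType) (k : nat) (L : kgraph k).

Inductive kpterm : Type :=
| TGen of kpath L
| TGhost of kpath L
| TZero
| TAdd of kpterm & kpterm
| TScale of R & kpterm
| TMul of kpterm & kpterm.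

HB.instance Definition _ := gen_eqMixin kpterm.
HB.instance Definition _ := gen_choiceMixin kpterm.

Fixpoint kpeval (A : nualg R) (S G : kpath L -> A) (t : kpterm) : A :=
  match t with
  | TGen l => S l
  | TGhost l => G l
  | TZero => 0
  | TAdd t u => kpeval S G t + kpeval S G u
  | TScale a t => a *: kpeval S G t
  | TMul t u => kpeval S G t ** kpeval S G u
  end.

Definition kpeqv (t u : kpterm) : bool :=
  `[< forall (A : nualg R) (S G : kpath L -> A), is_KP_family S G ->
        kpeval S G t = kpeval S G u >].

Lemma kpeqv_refl : reflexive kpeqv.
Proof. by move=> t; apply/asboolP. Qed.

Lemma kpeqv_sym : symmetric kpeqv.
Proof.
by move=> t u; apply/asboolP/asboolP => h A S G hS; rewrite (h A S G hS).
Qed.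

Lemma kpeqv_trans : transitive kpeqv.
Proof.
move=> u t w /asboolP h1 /asboolP h2; apply/asboolP => A S G hS.
by rewrite (h1 A S G hS) (h2 A S G hS).
Qed.

Canonical kpeqv_equiv := EquivRel kpeqv kpeqv_refl kpeqv_sym kpeqv_trans.

Definition kpcar : Type := {eq_quot kpeqv}%qT.
HB.instance Definition _ := Choice.on kpcar.

Definition kpclass (t : kpterm) : kpcar := (\pi_({eq_quot kpeqv}) t)%qT.
Definition kprep (x : kpcar) : kpterm := repr (x : {eq_quot kpeqv}%qT).
Definition kpval (A : nualg R) (S G : kpath L -> A) (x : kpcar) : A :=
  kpeval S G (kprep x).

Lemma kpval_class A S G : @is_KP_family R k L A S G ->
  forall t, kpval S G (kpclass t) = kpeval S G t.
Proof.
move=> hS t; rewrite /kpval /kprep /kpclass.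
have : kpeqv (repr (\pi_({eq_quot kpeqv}) t)%qT) t.
  by apply/(@eqquotP _ kpeqv_equiv {eq_quot kpeqv}%qT); rewrite reprK.
by move/asboolP; apply.
Qed.

Lemma kpcar_ext (x y : kpcar) :
  (forall (A : nualg R) (S G : kpath L -> A), is_KP_family S G ->
     kpval S G x = kpval S G y) -> x = y.
Proof.
move=> h; rewrite -[x](@reprK _ {eq_quot kpeqv}%qT).
rewrite -[y](@reprK _ {eq_quot kpeqv}%qT).
by apply/(@eqquotP _ kpeqv_equiv {eq_quot kpeqv}%qT)/asboolP.
Qed.

Definition kpadd (x y : kpcar) := kpclass (TAdd (kprep x) (kprep y)).
Definition kpscale (a : R) (x : kpcar) := kpclass (TScale a (kprep x)).
Definition kpopp (x : kpcar) := kpscale (-1) x.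
Definition kpzero := kpclass TZero.
Definition kpmul (x y : kpcar) := kpclass (TMul (kprep x) (kprep y)).

Lemma kpval_add A S G (h : @is_KP_family R k L A S G) x y :
  kpval S G (kpadd x y) = kpval S G x + kpval S G y.
Proof. exact: kpval_class. Qed.
Lemma kpval_scale A S G (h : @is_KP_family R k L A S G) a x :
  kpval S G (kpscale a x) = a *: kpval S G x.
Proof. exact: kpval_class. Qed.
Lemma kpval_mul A S G (h : @is_KP_family R k L A S G) x y :
  kpval S G (kpmul x y) = kpval S G x ** kpval S G y.
Proof. exact: kpval_class. Qed.
Lemma kpval_zero A S G (h : @is_KP_family R k L A S G) :
  kpval S G kpzero = 0.
Proof. exact: kpval_class. Qed.

Fact kpaddA : associative kpadd.
Proof.
by move=> x y z; apply: kpcar_ext => A S G h; rewrite !kpval_add// addrA.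
Qed.
Fact kpaddC : commutative kpadd.
Proof.
by move=> x y; apply: kpcar_ext => A S G h; rewrite !kpval_add// addrC.
Qed.
Fact kpadd0 : left_id kpzero kpadd.
Proof.
by move=> x; apply: kpcar_ext => A S G h; rewrite kpval_add// kpval_zero// add0r.
Qed.
Fact kpaddN : left_inverse kpzero kpopp kpadd.
Proof.
move=> x; apply: kpcar_ext => A S G h.
by rewrite kpval_add// kpval_zero// kpval_scale// scaleN1r addNr.
Qed.

HB.instance Definition _ :=
  GRing.isZmodule.Build kpcar kpaddA kpaddC kpadd0 kpaddN.

Fact kpscaleA a b x : kpscale a (kpscale b x) = kpscale (a * b) x.
Proof. by apply: kpcar_ext => A S G h; rewrite !kpval_scale// scalerA. Qed.
Fact kpscale1 : left_id 1 kpscale.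
Proof.
by move=> x; apply: kpcar_ext => A S G h; rewrite kpval_scale// scale1r.
Qed.
Fact kpscaleDr : right_distributive kpscale +%R.
Proof.
move=> a x y; apply: kpcar_ext => A S G h.
by rewrite !(kpval_scale, kpval_add)// scalerDr.
Qed.
Fact kpscaleDl x : {morph kpscale^~ x : a b / a + b}.
Proof.
move=> a b; apply: kpcar_ext => A S G h.
by rewrite !(kpval_scale, kpval_add)// scalerDl.
Qed.

HB.instance Definition _ := GRing.Zmodule_isLmodule.Build R kpcar
  kpscaleA kpscale1 kpscaleDr kpscaleDl.

Fact kpmulA (x y z : kpcar) : kpmul x (kpmul y z) = kpmul (kpmul x y) z.
Proof. by apply: kpcar_ext => A S G h; rewrite !kpval_mul// numulA. Qed.
Fact kpmulDl (x y z : kpcar) : kpmul (x + y) z = kpmul x z + kpmul y z.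
Proof.
by apply: kpcar_ext => A S G h; rewrite !(kpval_mul, kpval_add)// numulDl.
Qed.
Fact kpmulDr (x y z : kpcar) : kpmul x (y + z) = kpmul x y + kpmul x z.
Proof.
by apply: kpcar_ext => A S G h; rewrite !(kpval_mul, kpval_add)// numulDr.
Qed.
Fact kpmulZl (a : R) (x y : kpcar) : kpmul (a *: x) y = a *: kpmul x y.
Proof.
by apply: kpcar_ext => A S G h; rewrite !(kpval_mul, kpval_scale)// numulZl.
Qed.
Fact kpmulZr (a : R) (x y : kpcar) : kpmul x (a *: y) = a *: kpmul x y.
Proof.
by apply: kpcar_ext => A S G h; rewrite !(kpval_mul, kpval_scale)// numulZr.
Qed.

Definition KP : nualg R := NUAlg kpmulA kpmulDl kpmulDr kpmulZl kpmulZr.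

Definition kps (l : kpath L) : KP := kpclass (TGen l).
Definition kpg (l : kpath L) : KP := kpclass (TGhost l).

Lemma kpval_hom A S G : @is_KP_family R k L A S G ->
  @is_nuhom R KP A (kpval S G).
Proof.
by move=> h; split=> *; [exact: kpval_add|exact: kpval_scale|exact: kpval_mul].
Qed.

Lemma kpval_s A S G (h : @is_KP_family R k L A S G) l :
  kpval S G (kps l) = S l.
Proof. exact: kpval_class. Qed.
Lemma kpval_g A S G (h : @is_KP_family R k L A S G) l :
  kpval S G (kpg l) = G l.
Proof. exact: kpval_class. Qed.

Lemma kpval_sub A S G (h : @is_KP_family R k L A S G) (x y : KP) :
  kpval S G (x - y) = kpval S G x - kpval S G y.
Proof.
have e : kpval S G (x - y) + kpval S G y = kpval S G x.
  by rewrite -kpval_add//; congr kpval; exact: subrK.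
by rewrite -e addrK.
Qed.

Lemma kp_family : finitely_aligned L -> is_KP_family kps kpg.
Proof.
move=> fa; split.
- by move=> v; apply: kpcar_ext => A S G h;
    rewrite kpval_s// kpval_g// (KP_ghost_id h).
- move=> v w; apply: kpcar_ext => A S G h.
  rewrite kpval_mul// !kpval_s// (KP1 h).
  by case: (v == w); rewrite ?kpval_s//; rewrite [RHS]kpval_zero.
- move=> mu nu e; split; apply: kpcar_ext => A S G h.
    by rewrite kpval_mul// !kpval_s//; case: (KP2 h e).
  by rewrite kpval_mul// !kpval_g//; case: (KP2 h e).
- move=> mu nu; apply: kpcar_ext => A S G h.
  rewrite kpval_mul// kpval_s// kpval_g// (KP3 h) !fsbig_finite//=.
  rewrite (big_morph (kpval S G : KP -> A) (kpval_add h) (kpval_zero h)).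
  by apply: eq_bigr => p _; rewrite kpval_mul// kpval_s// kpval_g.
- move=> v E hE; apply: kpcar_ext => A S G h.
  rewrite [RHS]kpval_zero// -(KP4 h hE).
  rewrite (big_morph (kpval S G : KP -> A) (kpval_mul h) (kpval_s h (kid L v))).
  apply: eq_bigr => mu _.
  by rewrite kpval_sub// kpval_mul// !kpval_s// kpval_g.
Qed.

Theorem KP_universal : finitely_aligned L ->
  is_KP_family kps kpg /\
  forall (A : nualg R) (S G : kpath L -> A), is_KP_family S G ->
    exists! f : KP -> A,
      [/\ is_nuhom f, forall l, f (kps l) = S l & forall l, f (kpg l) = G l].
Proof.
move=> fa; split; first exact: kp_family.
move=> A S G h; exists (kpval S G : KP -> A); split.
  by split; [exact: kpval_hom|exact: kpval_s|exact: kpval_g].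
move=> f [[fD fZ fM] fs fg]; apply: funext => x.
rewrite /kpval -[in RHS](@reprK _ {eq_quot kpeqv}%qT x).
rewrite -/(kprep x) -/(kpclass (kprep x)); elim: (kprep x) => /=.
- by move=> l; rewrite -fs.
- by move=> l; rewrite -fg.
- have := fZ 0 (kpclass TZero : KP); rewrite !scale0r => <-.
  by congr f; rewrite scale0r.
- move=> t IHt u IHu; rewrite IHt IHu -fD; congr f.
  by apply: kpcar_ext => B T H hT; rewrite kpval_add// !kpval_class.
- move=> a t IHt; rewrite IHt -fZ; congr f.
  by apply: kpcar_ext => B T H hT; rewrite kpval_scale// !kpval_class.
- move=> t IHt u IHu; rewrite IHt IHu -fM; congr f.
  by apply: kpcar_ext => B T H hT; rewrite kpval_mul// !kpval_class.
Qed.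

End KumjianPask.

(* These are notions for the underlying (non-unital) ring of [A]; in
   particular ideals are not required to be closed under scalars. *)
Section PurelyInfinite.
Variables (R : comPzRingType) (A : nualg R).

Definition addsubgroup (I : set A) : Prop :=
  I 0 /\ forall x y, I x -> I y -> I (x - y).

Definition right_ideal (I : set A) : Prop :=
  addsubgroup I /\ forall x a, I x -> I (x ** a).

Definition two_sided_ideal (I : set A) : Prop :=
  right_ideal I /\ forall x a, I x -> I (a ** x).

Definition nusimple : Prop :=
  (exists x : A, x <> 0) /\
  forall I, two_sided_ideal I -> I = [set 0] \/ I = setT.

Definition rprincipal (e : A) : set A := [set e ** a | a in setT].

(* Right submodules of [A_A] are right ideals. *)
Definition proper_direct_summand (M P : set A) : Prop :=
  right_ideal M /\ M <> P /\
  exists N, [/\ right_ideal N, M `&` N = [set 0]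
              & P = [set x + y | x in M & y in N]].

Definition right_module_iso (M N : set A) : Prop :=
  exists f : A -> A,
    [/\ set_bij M N f,
        forall x y, M x -> M y -> f (x + y) = f x + f y
      & forall x a, M x -> f (x ** a) = f x ** a].

Definition infinite_idempotent (e : A) : Prop :=
  e ** e = e /\
  exists M, proper_direct_summand M (rprincipal e) /\
            right_module_iso (rprincipal e) M.

Definition purely_infinite : Prop :=
  forall I, right_ideal I -> I <> [set 0] ->
    exists e, I e /\ infinite_idempotent e.

Definition purely_infinite_simple : Prop := purely_infinite /\ nusimple.

End PurelyInfinite.

Definition is_field (R : comPzRingType) : Prop :=
  (1 : R) <> 0 /\ forall x : R, x <> 0 -> exists y : R, x * y = 1.

(* Main.v *)
(* A boundary path is determined by the set of its initial segments, a directed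
   prefix-closed set of paths meeting every finite exhaustive set (a boundary
   filter).  Such filters are obtained as ultrafilters of the commuting
   projections [s_l s_l^*]: given an element [a] outside a subgroup [J] stable
   under these projections, decide for one path [nu] after the other whether to
   multiply by [s_nu s_nu^*] or by its complement, always staying outside [J].

   Sufficiency.  If [a <> 0], an ultrafilter with [J = 0] yields a path [l]
   such that [a s_l] is a nonzero combination of distinct [s_t] with a common
   source; by aperiodicity one more path separates the [t]'s, so that some
   [y a z] is a vertex idempotent [s_w].  For simplicity, an ultrafilter avoiding an
   ideal [J] and cofinality show that [J] contains every vertex.  For pure
   infiniteness, [w] lies below a maximal class of the finite preorder above it;
   cofinality and the given cycle prevent this class from being one vertex
   without paths, so it contains a cycle [c], which aperiodicity allows one to
   choose incompatible with some path of the same range, and [s_c] makes its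
   vertex idempotent infinite.

   Necessity.  The algebra acts on functions on boundary filters, restricted to
   any shift-invariant set of them and optionally graded by [Z^k].  If [L] is
   not cofinal, the restriction to a suitable shift orbit kills a vertex; if [L]
   is not aperiodic, the ungraded action kills some [s_c - s_d] with
   [d(c) <> d(d)] that the graded one does not; if [r] is not invertible then
   [r KP] is a proper ideal.  Without a cycle some vertex [t] is terminal,
   [s_t KP s_t] is the field [R], and [s_t KP] is a minimal right ideal, which
   contains no infinite idempotent. *)
From HB Require Import structures.
Require Import Defs.
From mathcomp Require Import all_boot all_order all_algebra.
From mathcomp Require Import finmap zify.
From mathcomp Require Import boolp classical_sets functions cardinality fsbigop.

Set Implicit Arguments.
Unset Strict Implicit.
Unset Printing Implicit Defensive.

Import GRing.Theory.

Local Open Scope classical_set_scope.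
Local Open Scope ring_scope.

(** * Degrees and prefixes *)

Section Degrees.
Variable k : nat.
Implicit Types m n p : deg k.

Lemma degD m n i : (m + n) i = (m i + n i)%N. Proof. by rewrite ffunE. Qed.
Lemma deg0 i : (0 : deg k) i = 0%N. Proof. by rewrite ffunE. Qed.
Lemma dmaxE m n i : dmax m n i = maxn (m i) (n i). Proof. by rewrite ffunE. Qed.
Lemma dsubE m n i : dsub m n i = (m i - n i)%N. Proof. by rewrite ffunE. Qed.
Definition degE := (degD, deg0, dmaxE, dsubE).

Lemma degP m n : (forall i, m i = n i) -> m = n.
Proof. by move/ffunP. Qed.

Lemma deg_addI m : injective (+%R m : deg k -> deg k).
Proof.
by move=> n p /ffunP e; apply: degP => i; have := e i; rewrite !degE; lia.
Qed.

Lemma deg_addIl m : injective (fun n : deg k => n + m).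
Proof. by move=> n p; rewrite ![_ + m]addrC => /deg_addI. Qed.

Lemma dsubK m n : dle m n -> m + dsub n m = n.
Proof. by move=> le; apply: degP => i; rewrite !degE; have := le i; lia. Qed.

Lemma dle_refl m : dle m m. Proof. by move=> i. Qed.
Lemma dle_trans n m p : dle m n -> dle n p -> dle m p.
Proof. by move=> h h' i; exact: leq_trans (h i) (h' i). Qed.
Lemma dle_addr m n : dle m (m + n). Proof. by move=> i; rewrite degE leq_addr. Qed.
Lemma dle0 m : dle 0 m. Proof. by move=> i; rewrite degE. Qed.
Lemma dle_maxl m n : dle m (dmax m n).
Proof. by move=> i; rewrite degE leq_maxl. Qed.
Lemma dle_maxr m n : dle n (dmax m n).
Proof. by move=> i; rewrite degE leq_maxr. Qed.
Lemma dmax_le m n p : dle m p -> dle n p -> dle (dmax m n) p.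
Proof. by move=> h h' i; rewrite degE geq_max h h'. Qed.
Lemma dmax_same m : dmax m m = m.
Proof. by apply: degP => i; rewrite degE maxnn. Qed.
Lemma dmaxC m n : dmax m n = dmax n m.
Proof. by apply: degP => i; rewrite !degE maxnC. Qed.
Lemma deg_neqP m : m <> 0 -> exists i, (0 < m i)%N.
Proof.
move=> nz; apply: contrapT => h; apply: nz; apply: degP => i; rewrite degE.
by apply: contrapT => h'; apply: h; exists i; lia.
Qed.

End Degrees.

(** * Unique factorisation, the prefix order, minimal common extensions *)

Section Combinatorics.
Variables (k : nat) (L : kgraph k).
Implicit Types (v w : kvert L) (l mu nu a b c x y z : kpath L).

Lemma comp_inj2 a b a' b' : ksrc a = krng b -> ksrc a' = krng b' ->
  kdeg a = kdeg a' -> kcomp a b = kcomp a' b' -> a = a' /\ b = b'.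
Proof.
move=> h h' da e.
have db : kdeg b = kdeg b'.
  by have := congr1 (@kdeg _ L) e; rewrite !kdeg_comp// da => /deg_addI.
have [p [_ u]] := kfactor (kdeg_comp h).
have e1 := u (a, b) (And4 erefl erefl h erefl).
have e2 := u (a', b') (And4 (esym da) (esym db) h' e).
by have := etrans (esym e1) e2; case.
Qed.

Lemma comp_injl a b b' : ksrc a = krng b -> ksrc a = krng b' ->
  kcomp a b = kcomp a b' -> b = b'.
Proof. by move=> h h' e; case: (comp_inj2 h h' erefl e). Qed.

Lemma comp_injr a a' b : ksrc a = krng b -> ksrc a' = krng b ->
  kcomp a b = kcomp a' b -> a = a'.
Proof.
move=> h h' e; case: (comp_inj2 h h' _ e) => //.
by have := congr1 (@kdeg _ L) e; rewrite !kdeg_comp// => /deg_addIl.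
Qed.

Lemma split_deg l m : dle m (kdeg l) ->
  exists a b, [/\ kdeg a = m, ksrc a = krng b & l = kcomp a b].
Proof.
move/dsubK/esym/kfactor => [[a b] [[/= da db h e] _]].
by exists a, b.
Qed.

Lemma deg0_id l : kdeg l = 0 -> l = kid L (krng l).
Proof.
move=> d.
by case: (@comp_inj2 l (kid L (ksrc l)) (kid L (krng l)) l) => //;
  rewrite ?krng_id ?ksrc_id ?kdeg_id ?kcomp_idl ?kcomp_idr.
Qed.

Lemma kdeg0_src l : kdeg l = 0 -> ksrc l = krng l.
Proof. by move=> /deg0_id ->; rewrite krng_id ksrc_id. Qed.

Definition pre a b := exists2 c, ksrc a = krng c & b = kcomp a c.

Lemma pre_comp a c : ksrc a = krng c -> pre a (kcomp a c).
Proof. by move=> h; exists c. Qed.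

Lemma pre_refl a : pre a a.
Proof. by exists (kid L (ksrc a)); rewrite ?krng_id ?kcomp_idr. Qed.

Lemma pre_trans b a c : pre a b -> pre b c -> pre a c.
Proof.
move=> [x hx ->] [y]; rewrite ksrc_comp// => hy ->.
by exists (kcomp x y); rewrite ?krng_comp// kcompA.
Qed.

Lemma pre_rng a b : pre a b -> krng a = krng b.
Proof. by move=> [c h ->]; rewrite krng_comp. Qed.

Lemma pre_id v l : krng l = v -> pre (kid L v) l.
Proof. by move=> <-; exists l; rewrite ?ksrc_id ?kcomp_idl. Qed.

Lemma pre_deg a b : pre a b -> dle (kdeg a) (kdeg b).
Proof. by move=> [c h ->]; rewrite kdeg_comp//; exact: dle_addr. Qed.

Lemma pre_eq a b : pre a b -> dle (kdeg b) (kdeg a) -> a = b.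
Proof.
move=> [c h e] le; have dc : kdeg c = 0.
  apply: degP => i; have := le i; rewrite e kdeg_comp// !degE; lia.
by rewrite e (deg0_id dc) -h kcomp_idr.
Qed.

(** Unique factorisation gives [l] a single prefix in each degree below its own, so prefixes of [l]
    are ordered as their degrees. *)
Lemma pre_chain a b l : pre a l -> pre b l -> dle (kdeg a) (kdeg b) -> pre a b.
Proof.
move=> [x hx ex] [y hy ey] /split_deg[a' [b' [da h e]]].
have hb' : ksrc b' = krng y by rewrite -hy e ksrc_comp.
have e2 : kcomp a x = kcomp a' (kcomp b' y) by rewrite kcompA// -e -ey.
have [-> _] := comp_inj2 hx (etrans h (esym (krng_comp hb'))) (esym da) e2.
by rewrite e; exact: pre_comp.
Qed.

Lemma pre_same a b l : pre a l -> pre b l -> kdeg a = kdeg b -> a = b.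
Proof.
move=> ha hb d; apply: pre_eq; last by rewrite d; exact: dle_refl.
by apply: pre_chain ha hb _; rewrite d; exact: dle_refl.
Qed.

Lemma pre_of_deg l m : dle m (kdeg l) -> exists2 a, pre a l & kdeg a = m.
Proof. by move=> /split_deg[a [b [d h ->]]]; exists a => //; exact: pre_comp. Qed.

Lemma pre_compl a b c : ksrc a = krng b ->
  pre (kcomp a b) (kcomp a c) -> ksrc a = krng c -> pre b c.
Proof.
move=> hb [x]; rewrite ksrc_comp// => hx e hc.
exists x => //; rewrite -kcompA// in e.
by apply: comp_injl e; rewrite ?krng_comp.
Qed.

Lemma pre_compr a b c : ksrc a = krng b -> pre b c -> pre (kcomp a b) (kcomp a c).
Proof.
move=> hb [x hx ->]; exists x; rewrite ?ksrc_comp//.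
by rewrite kcompA.
Qed.

(** By [compat_Lmin] this is nonemptiness of [Lmin], the condition occurring in exhaustiveness. *)
Definition compat a b := exists2 c, pre a c & pre b c.

Lemma compat_sym a b : compat a b -> compat b a.
Proof. by move=> [c]; exists c. Qed.

Lemma compat_prel a a' b : pre a' a -> compat a b -> compat a' b.
Proof. by move=> h [c ha hb]; exists c => //; exact: pre_trans ha. Qed.

Lemma compat_comp l a b : ksrc l = krng a -> ksrc l = krng b ->
  compat (kcomp l a) (kcomp l b) <-> compat a b.
Proof.
move=> ha hb; split=> [[c pa pb]|[c pa pb]]; last first.
  by exists (kcomp l c); apply: pre_compr.
have [d hd e] := pre_trans (pre_comp ha) pa; subst c.
by exists d; apply: pre_compl; eauto.
Qed.

Lemma MCE_pre mu nu l : MCE mu nu l <->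
  [/\ kdeg l = dmax (kdeg mu) (kdeg nu), pre mu l & pre nu l].
Proof.
split=> [[d [a [b [ha ea hb eb]]]]|[d [a ha ea] [b hb eb]]].
  by split=> //; [exists a|exists b].
by split=> //; exists a, b.
Qed.

Lemma Lmin_MCE mu nu p : Lmin mu nu p -> MCE mu nu (kcomp mu p.1).
Proof. by case. Qed.

Lemma MCE_Lmin mu nu l : MCE mu nu l ->
  exists2 p, Lmin mu nu p & l = kcomp mu p.1 /\ l = kcomp nu p.2.
Proof.
move=> h; case: (h) => d [a [b [ha ea hb eb]]].
by exists (a, b) => //; split=> //=; rewrite -?ea.
Qed.

(** The prefix of [x] in degree [dmax (kdeg mu) (kdeg nu)] does it, by [pre_chain]. *)
Lemma MCE_of_ext mu nu x : pre mu x -> pre nu x ->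
  exists2 l, MCE mu nu l & pre l x.
Proof.
move=> hm hn.
have le : dle (dmax (kdeg mu) (kdeg nu)) (kdeg x) by apply: dmax_le; exact: pre_deg.
have [l pl dl] := pre_of_deg le.
exists l => //; apply/MCE_pre; split=> //.
  by apply: pre_chain hm pl _; rewrite dl; exact: dle_maxl.
by apply: pre_chain hn pl _; rewrite dl; exact: dle_maxr.
Qed.

Lemma compat_Lmin mu nu : compat mu nu <-> Lmin mu nu !=set0.
Proof.
split=> [[c h h']|[p [h1 h2 e _]]].
  by have [l /MCE_Lmin[p hp _] _] := MCE_of_ext h h'; exists p.
exists (kcomp mu p.1); first exact: pre_comp.
by rewrite e; exact: pre_comp.
Qed.

Lemma Lmin_fst mu nu p q : Lmin mu nu p -> Lmin mu nu q -> p.1 = q.1 -> p = q.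
Proof.
case: p => p1 p2; case: q => q1 q2 [/= h1 h2 e _] [/= h1' h2' e' _] ?; subst q1.
by congr pair; apply: comp_injl h2 h2' _; rewrite -e.
Qed.

Lemma Lmin_deg mu nu p : Lmin mu nu p ->
  kdeg p.1 = dsub (kdeg nu) (kdeg mu) /\ kdeg p.2 = dsub (kdeg mu) (kdeg nu).
Proof.
move=> [h1 h2 e [d _]]; rewrite kdeg_comp// in d.
have d2 : kdeg nu + kdeg p.2 = dmax (kdeg mu) (kdeg nu).
  by rewrite -kdeg_comp// -e kdeg_comp.
split; apply: degP => i.
  by have /ffunP/(_ i) := d; rewrite !degE; lia.
by have /ffunP/(_ i) := d2; rewrite !degE; lia.
Qed.

(* Two extensions of common degree have one common prefix of degree [dmax]. *)
Lemma Lmin_uniq mu nu p q x : Lmin mu nu p -> Lmin mu nu q ->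
  pre (kcomp mu p.1) x -> pre (kcomp mu q.1) x -> p = q.
Proof.
move=> hp hq xp xq; apply: (Lmin_fst hp hq).
case: (hp) => h1 _ _ [d1 _]; case: (hq) => h2 _ _ [d2 _].
by apply: (comp_injl h1 h2); apply: pre_same xp xq _; rewrite d1 d2.
Qed.

Section Aligned.
Hypothesis fa : finitely_aligned L.

Definition lmins mu nu : {fset kpath L * kpath L} := fset_set (Lmin mu nu).

Lemma lminsP mu nu p : p \in lmins mu nu <-> Lmin mu nu p.
Proof. by rewrite in_fset_set//; split=> [/set_mem|/mem_set]. Qed.

(** The set usually written Ext([l]; [N]): the tails that extend [l] minimally to an extension of
    some member of [N]. *)
Definition exts l (N : {fset kpath L}) : {fset kpath L} :=
  seq_fset tt (flatten [seq [seq p.1 | p <- lmins l nu] | nu <- N]).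

Lemma extsP l N a : a \in exts l N <-> exists2 nu, nu \in N & exists b, Lmin l nu (a, b).
Proof.
rewrite /exts seq_fsetE; split=> [/flattenP[s /mapP[nu hn ->]]|[nu hn [b h]]].
  by move=> /mapP[[a' b] /lminsP h /= ->]; exists nu => //; exists b.
apply/flattenP; exists [seq p.1 | p <- lmins l nu]; first exact: map_f.
by apply/mapP; exists (a, b) => //; apply/lminsP.
Qed.

(** A common extension of [l a] and [nu] has a prefix [l a'] that is minimal for [l] and [nu];
    cancelling [l] shows [a] and [a'] compatible. *)
Lemma exts_exhaustive l (N : {fset kpath L}) :
  (forall a, ksrc l = krng a -> exists2 nu, nu \in N & compat (kcomp l a) nu) ->
  exhaustive (ksrc l) [set` exts l N].
Proof.
move=> h; split=> [mu /extsP[nu _ [b [/= <-]]]//|a /esym ha].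
have [nu hn [c p1 p2]] := h a ha.
have [m /MCE_Lmin[[a' b] hl [/= e e']] pm] := MCE_of_ext (pre_trans (pre_comp ha) p1) p2.
exists a'; split; first by apply/extsP; exists nu => //; exists b.
apply/compat_Lmin; case: (hl) => /= h1 _ _ _.
by apply/(compat_comp ha h1); exists c => //; rewrite -e.
Qed.

End Aligned.

(* The sets of initial segments of boundary paths, see [pfil_bf] and
   [filter_path]. *)
Definition bdfilter (U : set (kpath L)) :=
  [/\ exists l, U l,
      forall a b, pre a b -> U b -> U a,
      forall a b, U a -> U b -> exists2 c, U c & pre a c /\ pre b c
    & forall l E, U l -> FE (ksrc l) E -> exists2 mu, mu \in E & U (kcomp l mu)].

(** * Order properties of boundary filters *)

Section Filters.
Variable U : set (kpath L).
Hypothesis hU : bdfilter U.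

Lemma bf_her a b : pre a b -> U b -> U a.
Proof. by case: hU => _ h _ _; exact: h. Qed.
Lemma bf_dir a b : U a -> U b -> exists2 c, U c & pre a c /\ pre b c.
Proof. by case: hU => _ _ h _; exact: h. Qed.
Lemma bf_bd l E : U l -> FE (ksrc l) E -> exists2 mu, mu \in E & U (kcomp l mu).
Proof. by case: hU => _ _ _ h; exact: h. Qed.

Lemma bf_rng a b : U a -> U b -> krng a = krng b.
Proof. by move=> ha hb; have [c _ [/pre_rng -> /pre_rng ->]] := bf_dir ha hb. Qed.

Lemma bf_id a : U a -> U (kid L (krng a)).
Proof. by move=> h; apply: bf_her h; exact: pre_id. Qed.

Lemma bf_same a b : U a -> U b -> kdeg a = kdeg b -> a = b.
Proof. by move=> ha hb; have [c _ [h h']] := bf_dir ha hb; exact: pre_same h h'. Qed.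

Lemma bf_chain a b : U a -> U b -> dle (kdeg a) (kdeg b) -> pre a b.
Proof. by move=> ha hb; have [c _ [h h']] := bf_dir ha hb; exact: pre_chain h h'. Qed.

Lemma bf_sup (s : seq (kpath L)) l0 : U l0 -> 
  exists l, [/\ U l, pre l0 l & forall a, a \in s -> U a -> pre a l].
Proof.
move=> hl0; elim: s => [|a s [l [hl p0 hs]]]; first by exists l0; split=> //; exact: pre_refl.
have [ha|ha] := pselect (U a); last first.
  exists l; split=> // b; rewrite inE => /predU1P[->|]; [by []|exact: hs].
have [c hc [p1 p2]] := bf_dir hl ha.
exists c; split=> //; first exact: pre_trans p0 p1.
move=> b; rewrite inE => /predU1P[-> //|hb ub].
by apply: pre_trans p1; exact: hs.
Qed.

(* Otherwise the minimal extensions of [l] towards [N] would form a finite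
   exhaustive set avoided by [U]. *)
Lemma bf_avoid l (N : {fset kpath L}) : finitely_aligned L ->
  U l -> (forall nu, nu \in N -> ~ U nu) ->
  exists2 a, ksrc l = krng a & forall nu, nu \in N -> ~ compat (kcomp l a) nu.
Proof.
move=> fa hl hN; apply: contrapT => h.
have ex : exhaustive (ksrc l) [set` exts l N].
  apply: exts_exhaustive => // a ha; apply: contrapT => h'; apply: h.
  by exists a => // nu hn hc; apply: h'; exists nu.
have key a : a \in exts l N -> ~ U (kcomp l a).
  move=> /(extsP fa)[nu /hN hn [b [/= h1 h2 e _]]] ua; apply: hn.
  by apply: bf_her ua; rewrite e; exact: pre_comp.
have [hi|hi] := boolP (kid L (ksrc l) \in exts l N).
  by have := key _ hi; rewrite kcomp_idr.
by have [mu /key] := bf_bd hl (conj ex hi).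
Qed.

End Filters.

(* In terms of boundary paths, [strip l] is the shift by d(l) and [prep l] the
   concatenation with [l]. *)
Definition strip l (U : set (kpath L)) : set (kpath L) :=
  [set a | ksrc l = krng a /\ U (kcomp l a)].
Definition prep l (U : set (kpath L)) : set (kpath L) :=
  [set b | exists2 a, U a /\ ksrc l = krng a & pre b (kcomp l a)].

Lemma strip_id v U : bdfilter U -> U (kid L v) -> strip (kid L v) U = U.
Proof.
move=> hU hv; apply/seteqP; split=> a /=; rewrite /strip /= ksrc_id.
  by move=> [-> ]; rewrite kcomp_idl.
move=> ha; have e := bf_rng hU ha hv; rewrite krng_id in e.
by split=> //; rewrite -e kcomp_idl.
Qed.

Lemma strip_comp l m U : ksrc l = krng m -> strip (kcomp l m) U = strip m (strip l U).
Proof.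
move=> h; apply/seteqP; split=> a; rewrite /strip /= ksrc_comp//.
  by move=> [h1 h2]; rewrite krng_comp// kcompA.
by move=> [h1 [h2]]; rewrite kcompA.
Qed.

Lemma bf_strip l U : bdfilter U -> U l -> bdfilter (strip l U).
Proof.
move=> hU hl; split.
- by exists (kid L (ksrc l)); split; rewrite ?krng_id ?kcomp_idr.
- move=> a b pab [hb ub]; have ha : ksrc l = krng a by rewrite (pre_rng pab).
  by split=> //; apply: (bf_her hU) ub; exact: pre_compr.
- move=> a b [ha ua] [hb ub]; have [c uc [pa pb]] := bf_dir hU ua ub.
  have [d hd e] := pre_trans (pre_comp ha) pa; subst c.
  by exists d => //; split; apply: pre_compl; eauto.
- move=> a E [ha ua] hE.
  have [|mu hmu umu] := bf_bd hU ua (E := E); first by rewrite ksrc_comp.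
  have hr : krng mu = ksrc a by case: hE => -[h _] _; exact: h.
  exists mu => //; split; first by rewrite krng_comp.
  by rewrite kcompA.
Qed.

Lemma prepE l U a : bdfilter U -> U (kid L (ksrc l)) -> ksrc l = krng a ->
  prep l U (kcomp l a) <-> U a.
Proof.
move=> hU hl ha; split=> [[b [ub hb] p]|ua].
  by apply: (bf_her hU) ub; exact: pre_compl p hb.
by exists a => //; exact: pre_refl.
Qed.

(** Only the boundary condition is at stake. For [E] at the source of a prefix [a] of [l a'], the
    tails from [l a'] towards the paths [a mu] form a finite exhaustive set [F] at the source of
    [a'], where the boundary condition of [U] applies. *)
Lemma bf_prep l U : finitely_aligned L ->
  bdfilter U -> U (kid L (ksrc l)) -> bdfilter (prep l U).
Proof.
move=> fa hU hl.
have inU a : U a -> ksrc l = krng a.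
  by move=> ha; have := bf_rng hU ha hl; rewrite krng_id.
have her a b : pre a b -> prep l U b -> prep l U a.
  by move=> pab [c uc pc]; exists c => //; exact: pre_trans pc.
split=> //.
- by exists l; exists (kid L (ksrc l)); rewrite ?krng_id ?kcomp_idr //; exact: pre_refl.
- move=> a b [a' [ua ha] pa] [b' [ub hb] pb].
  have [c uc [pac pbc]] := bf_dir hU ua ub.
  have hc := inU _ uc.
  exists (kcomp l c); first by exists c => //; exact: pre_refl.
  by split; [apply: pre_trans pa _|apply: pre_trans pb _]; exact: pre_compr.
- move=> a E [a' [ua ha] [d hd ed]] [[hE1 hE2] hE3].
  have src_c : ksrc (kcomp l a') = ksrc a' by rewrite ksrc_comp.
  pose F := exts (kcomp l a') (seq_fset tt [seq kcomp a mu | mu <- E]).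
  have FP b : b \in F -> exists2 mu, mu \in E & pre (kcomp a mu) (kcomp (kcomp l a') b).
    move=> /(extsP fa)[nu]; rewrite seq_fsetE => /mapP[mu hmu ->] [b' [/= h1 h2 e _]].
    by exists mu => //; rewrite e; exact: pre_comp.
  have ex : exhaustive (ksrc a') [set` F].
    rewrite -src_c; apply: (exts_exhaustive fa) => b hb.
    have hb' : ksrc d = krng b by rewrite -hb ed ksrc_comp.
    have [mu [hmu /compat_Lmin cm]] := hE2 (kcomp d b) (etrans (krng_comp hb') (esym hd)).
    have hr : krng mu = ksrc a by exact: hE1.
    exists (kcomp a mu); first by rewrite seq_fsetE; exact: map_f.
    rewrite ed -kcompA//; apply/(compat_comp _ _) => //.
    by rewrite krng_comp.
  (* If the vertex lies in [F], then [l a'] already extends some [a mu]. *)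
  have [hi|hi] := boolP (kid L (ksrc a') \in F).
    have [mu hmu pm] := FP _ hi; exists mu => //.
    by rewrite -src_c kcomp_idr in pm; exists a'.
  have [b hb ub] := bf_bd hU ua (conj ex hi).
  have hr : krng b = ksrc a' by case: ex => h _; exact: h.
  have [mu hmu pm] := FP _ hb; exists mu => //.
  exists (kcomp a' b); first by split=> //; rewrite krng_comp.
  by rewrite kcompA.
Qed.

Lemma strip_prep l U : bdfilter U -> U (kid L (ksrc l)) -> strip l (prep l U) = U.
Proof.
move=> hU hl; apply/seteqP; split=> a /=.
  by move=> [h]; rewrite prepE.
move=> ua; have h : ksrc l = krng a by have := bf_rng hU ua hl; rewrite krng_id.
by split=> //; rewrite prepE.
Qed.

Lemma prep_strip l U : bdfilter U -> U l -> prep l (strip l U) = U.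
Proof.
move=> hU hl; apply/seteqP; split=> a /=.
  by move=> [b [[hb ub] _] p]; exact: (bf_her hU) ub.
move=> ua; have [c uc [pl pa]] := bf_dir hU hl ua.
by have [b hb e] := pl; subst c; exists b.
Qed.

Lemma prep_comp l m U : ksrc l = krng m -> bdfilter U -> U (kid L (ksrc m)) ->
  prep (kcomp l m) U = prep l (prep m U).
Proof.
move=> h hU hm.
have inU a : U a -> ksrc m = krng a.
  by move=> ha; have := bf_rng hU ha hm; rewrite krng_id.
apply/seteqP; split=> a [b].
  rewrite ksrc_comp// => -[ub hb]; rewrite -kcompA// => p.
  exists (kcomp m b) => //; split; last by rewrite krng_comp.
  by exists b => //; exact: pre_refl.
move=> [[c [uc hc] pc] hb] p; exists c; first by rewrite ksrc_comp.
by rewrite -kcompA//; apply: pre_trans p _; exact: pre_compr.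
Qed.

Lemma prep_in l U : U (kid L (ksrc l)) -> prep l U l.
Proof.
by move=> h; exists (kid L (ksrc l)); rewrite ?krng_id ?kcomp_idr//; exact: pre_refl.
Qed.

Lemma strip_in l U : U l -> strip l U (kid L (ksrc l)).
Proof. by move=> h; split; rewrite ?krng_id ?kcomp_idr. Qed.

End Combinatorics.

(** * Boundary paths as filters *)

Section BoundaryPaths.
Variables (k : nat) (L : kgraph k).
Implicit Types (v w : kvert L) (l mu nu a c : kpath L) (m n p q : deg k).
Implicit Types (x y : omap_data L) (U : set (kpath L)).

Definition pfil x : set (kpath L) :=
  [set l | exists2 p, dlex p (xd x) & l = xmor x 0 p].

Lemma dlex_le p q (d : xdeg k) : dle p q -> dlex q d -> dlex p d.
Proof.
move=> le h i; have := h i; have := le i; case: (d i) => // b; exact: leq_trans.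
Qed.

Lemma dlex_max p q (d : xdeg k) : dlex p d -> dlex q d -> dlex (dmax p q) d.
Proof.
move=> hp hq i; have := hp i; have := hq i; case: (d i) => // b.
by rewrite degE geq_max => -> ->.
Qed.

Lemma dlex_sub m n (d : xdeg k) : dlex n d -> dlex m (xsub d n) <-> dlex (n + m) d.
Proof.
move=> hn; split=> h i; have := h i; have := hn i; rewrite !ffunE;
  case: (d i) => //= b; lia.
Qed.

Lemma xdeg_ext (d e : xdeg k) : (forall p, dlex p d <-> dlex p e) -> d = e.
Proof.
move=> h; apply/ffunP => i.
(* Degrees supported at the coordinate [i] test [d i] alone. *)
pose s (b : nat) : deg k := [ffun j => if j == i then b else 0%N].
have hs (b : nat) (f : xdeg k) :
    dlex (s b) f <-> (if f i is Some c then (b <= c)%N else true).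
  split=> [h'|hb j]; first by have := h' i; rewrite /s ffunE eqxx; case: (f i).
  by rewrite /s ffunE; case: eqP => [->|_]; [move: hb; case: (f i)|case: (f j)].
have {hs}h (b : nat) := iff_trans (iff_sym (hs b d)) (iff_trans (h (s b)) (hs b e)).
case: (d i) h => [b|]; case: (e i) => [c|] // h.
- have := (h b).1 (leqnn _); have := (h c).2 (leqnn _).
  by move=> h1 h2; congr Some; apply/eqP; rewrite eqn_leq h1 h2.
- by have := (h b.+1).2 isT; rewrite ltnn.
- by have := (h c.+1).1 isT; rewrite ltnn.
Qed.

Section OfPath.
Variable x : omap_data L.
Hypothesis hx : is_degree_functor x.

Lemma xmor_rs p q : dle p q -> dlex q (xd x) ->
  krng (xmor x p q) = xobj x p /\ ksrc (xmor x p q) = xobj x q.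
Proof. by case: hx => h _ _ _; exact: h. Qed.
Lemma xmor_comp p q r : dle p q -> dle q r -> dlex r (xd x) ->
  xmor x p r = kcomp (xmor x p q) (xmor x q r).
Proof. by case: hx => _ _ h _; exact: h. Qed.
Lemma xmor_deg p q : dle p q -> dlex q (xd x) -> kdeg (xmor x p q) = dsub q p.
Proof. by case: hx => _ _ _ h; exact: h. Qed.
Lemma xmor0_deg p : dlex p (xd x) -> kdeg (xmor x 0 p) = p.
Proof.
move=> h; rewrite xmor_deg//; last exact: dle0.
by apply: degP => i; rewrite !degE subn0.
Qed.

Lemma pfilP l : pfil x l <-> dlex (kdeg l) (xd x) /\ l = xmor x 0 (kdeg l).
Proof.
split=> [[p hp ->]|[h e]]; last by exists (kdeg l).
by rewrite xmor0_deg.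
Qed.

Lemma xmor_uniq p q l : dle p q -> dlex q (xd x) -> ksrc (xmor x 0 p) = krng l ->
  xmor x 0 q = kcomp (xmor x 0 p) l -> l = xmor x p q.
Proof.
move=> le hq hl; have hp := dlex_le le hq.
have [_ e] := xmor_rs (dle0 p) hp; have [e' _] := xmor_rs le hq.
rewrite (xmor_comp (dle0 p) le hq) => /esym; apply: comp_injl => //.
by rewrite e e'.
Qed.

Lemma strip_pfil n l : dlex n (xd x) -> strip (xmor x 0 n) (pfil x) l <->
  dlex (n + kdeg l) (xd x) /\ l = xmor x n (n + kdeg l).
Proof.
move=> hn; have [_ e] := xmor_rs (dle0 n) hn.
split=> [[hl /pfilP]|[hd hl]].
  rewrite kdeg_comp// xmor0_deg// => -[hd /esym h]; split=> //.
  by apply: xmor_uniq => //; exact: dle_addr.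
have le : dle n (n + kdeg l) by exact: dle_addr.
have [e' _] := xmor_rs le hd; rewrite -hl in e'.
split; first by rewrite e e'.
exists (n + kdeg l) => //.
by rewrite (xmor_comp (dle0 n) le hd) -hl.
Qed.

End OfPath.

Lemma pfil_bf x : is_boundary_path x -> bdfilter (pfil x).
Proof.
move=> [hx hb].
have her a b : pre a b -> pfil x b -> pfil x a.
  move=> [c hc ->] /pfilP -/(_ hx)[]; rewrite kdeg_comp// => hd.
  have le := dle_addr (kdeg a) (kdeg c).
  have hp := dlex_le le hd.
  have [_ e] := xmor_rs hx (dle0 _) hp; have [e' _] := xmor_rs hx le hd.
  rewrite (xmor_comp hx (dle0 _) le hd) => ee.
  have [||ea _] := comp_inj2 hc _ _ ee; first by rewrite e e'.
    by rewrite xmor0_deg.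
  by exists (kdeg a).
split=> //.
- exists (xmor x 0 0); exists 0 => //.
  by move=> i; rewrite degE; case: (xd x i).
- move=> a b /pfilP -/(_ hx)[ha ea] /pfilP -/(_ hx)[hb' eb].
  have hm := dlex_max ha hb'.
  exists (xmor x 0 (dmax (kdeg a) (kdeg b))); first by exists (dmax (kdeg a) (kdeg b)).
  have aux c : dle (kdeg c) (dmax (kdeg a) (kdeg b)) -> c = xmor x 0 (kdeg c) ->
      pre c (xmor x 0 (dmax (kdeg a) (kdeg b))).
    move=> le ec; rewrite (xmor_comp hx (dle0 _) le hm) -ec; apply: pre_comp.
    have [e' _] := xmor_rs hx le hm; rewrite {1}ec e'.
    by case: (xmor_rs hx (dle0 _) (dlex_le le hm)).
  by split; apply: aux => //; [exact: dle_maxl|exact: dle_maxr].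
- move=> l E /pfilP -/(_ hx)[hl el] hE.
  have [_ e] := xmor_rs hx (dle0 _) hl.
  rewrite el e in hE; have [mu [hmu hd emu]] := hb _ hl _ hE.
  exists mu => //; exists (kdeg l + kdeg mu) => //.
  by rewrite (xmor_comp hx (dle0 _) (dle_addr _ _) hd) emu -el.
Qed.

Section OfFilter.
Variable U : set (kpath L).
Hypothesis hU : bdfilter U.

(** In each coordinate, the largest degree occurring in [U], or infinity if there is none. *)
Definition fdeg : xdeg k := [ffun i =>
  match pselect (exists b, (exists2 l, U l & kdeg l i = b) /\
                           forall l, U l -> (kdeg l i <= b)%N) with
  | left h => Some (projT1 (cid h)) | right _ => None end].

(** The member of [U] of degree [n], unique by [bf_same]; the default [l0] is only reached when [n]
    is not below [fdeg]. *)
Definition fpth l0 n := xget l0 [set l | U l /\ kdeg l = n].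
Definition fmor l0 p q :=
  xget l0 [set c | ksrc (fpth l0 p) = krng c /\ fpth l0 q = kcomp (fpth l0 p) c].

Lemma fdeg_unbounded i : fdeg i = None -> forall b, exists2 l, U l & (b <= kdeg l i)%N.
Proof.
rewrite ffunE; case: pselect => // h _ b; apply: contrapT => hb; apply: h.
have {}hb l : U l -> (kdeg l i <= b)%N.
  by move=> hl; rewrite leqNgt; apply/negP => lt; apply: hb; exists l => //; exact: ltnW.
elim: b hb => [|b IH] hb.
  have [l hl] : exists l, U l by case: hU.
  by exists 0%N; split=> //; exists l => //; have := hb _ hl; lia.
have [[l hl e]|h] := pselect (exists2 l, U l & kdeg l i = b.+1).
  by exists b.+1; split=> //; exists l.
apply: IH => l hl; have := hb _ hl; rewrite leq_eqVlt => /predU1P[e|//].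
by exfalso; apply: h; exists l.
Qed.

(** From left to right: choose for each coordinate [i] a member [f i] whose degree is at least [n i]
    there. An upper bound in [U] of these finitely many members has a prefix of degree [n]. *)
Lemma fdegP n : dlex n fdeg <-> exists2 l, U l & kdeg l = n.
Proof.
split=> [h|[l hl <-] i]; last first.
  by rewrite ffunE; case: pselect => // hh; case: cid => b /= [_]; exact.
have hi i : exists2 l, U l & (n i <= kdeg l i)%N.
  have := h i; case e: (fdeg i) => [b|] hb; last exact: fdeg_unbounded.
  move: e; rewrite ffunE; case: pselect => // hh; case: cid => c /= [[l hl el] _] [cb].
  by exists l => //; rewrite el cb.
pose f i := projT1 (cid2 (hi i)).
have fU i : U (f i) by rewrite /f; case: cid2.
have fn i : (n i <= kdeg (f i) i)%N by rewrite /f; case: cid2.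
have [l0 hl0] : exists l, U l by case: hU.
have [l [hl _ hs]] := bf_sup hU [seq f i | i <- enum 'I_k] hl0.
have le : dle n (kdeg l).
  move=> i; apply: leq_trans (fn i) _; apply: pre_deg; apply: hs => //.
  by apply: map_f; rewrite mem_enum.
have [a pa da] := pre_of_deg le.
by exists a => //; exact: (bf_her hU) hl.
Qed.

(** The morphism (p, q) goes to the tail of the member of degree q after the member of degree p.
    Cancellation yields functoriality, and the boundary condition at p is that of [U] at the member
    of degree p. *)
Lemma filter_path : exists2 x, is_boundary_path x & pfil x = U.
Proof.
have [l0 hl0] : exists l, U l by case: hU.
pose x := OmapData fdeg (fun p => ksrc (fpth l0 p)) (fmor l0).
have hp n : dlex n fdeg -> U (fpth l0 n) /\ kdeg (fpth l0 n) = n.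
  by move=> /fdegP[l hl el]; apply: (@xgetPex _ l0 [set l | U l /\ kdeg l = n]); exists l.
have hpu l : U l -> fpth l0 (kdeg l) = l.
  move=> hl; have [|h1 h2] := hp (kdeg l); first by apply/fdegP; exists l.
  by apply: (bf_same hU).
have hm p q : dle p q -> dlex q fdeg -> ksrc (fpth l0 p) = krng (fmor l0 p q) /\
    fpth l0 q = kcomp (fpth l0 p) (fmor l0 p q).
  move=> le hq; have [h1 h2] := hp _ hq; have [h3 h4] := hp _ (dlex_le le hq).
  have [|c hc e] := bf_chain hU h3 h1; first by rewrite h4 h2.
  by apply: (@xgetPex _ l0 [set c0 | ksrc (fpth l0 p) = krng c0 /\
    fpth l0 q = kcomp (fpth l0 p) c0]); exists c.
have hx : is_degree_functor x.
  split=> /=.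
  - move=> p q le hq; have [h1 ->] := hm _ _ le hq; rewrite ksrc_comp//; split=> //.
  - move=> p hq; have [h1 e] := hm _ _ (dle_refl p) hq.
    apply: (comp_injl (esym (esym h1))); rewrite -?e ?kcomp_idr//.
    by rewrite krng_id.
  - move=> p q r le1 le2 hr; have hq := dlex_le le2 hr.
    have [h1 e1] := hm _ _ (dle_trans le1 le2) hr.
    have [h2 e2] := hm _ _ le1 hq; have [h3 e3] := hm _ _ le2 hr.
    have h4 : ksrc (fmor l0 p q) = krng (fmor l0 q r) by rewrite -h3 e2 ksrc_comp.
    apply: (@comp_injl _ _ (fpth l0 p)) => //; first by rewrite krng_comp.
    by rewrite kcompA// -e2 -e3.
  - move=> p q le hq; have [h1 e] := hm _ _ le hq.
    have [_ d1] := hp _ hq; have [_ d2] := hp _ (dlex_le le hq).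
    apply: (@deg_addI _ p); rewrite (dsubK le).
    by have := congr1 (@kdeg _ L) e; rewrite kdeg_comp// d1 d2.
have e0 p : dlex p fdeg -> fmor l0 0 p = fpth l0 p.
  move=> hd; have [h1 e] := hm _ _ (dle0 p) hd.
  have hd0 := dlex_le (dle0 p) hd.
  rewrite e [in RHS](deg0_id (hp _ hd0).2) -(kdeg0_src (hp _ hd0).2) h1.
  by rewrite kcomp_idl.
exists x; last first.
  apply/seteqP; split=> l /=.
    by move=> [p hd ->]; rewrite /= e0//; case: (hp _ hd).
  move=> hl; have hd : dlex (kdeg l) fdeg by apply/fdegP; exists l.
  by exists (kdeg l); rewrite //= e0// hpu.
split=> // p /= hd E hE; have [h1 h2] := hp _ hd.
have [mu hmu umu] := bf_bd hU h1 hE.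
have hr : krng mu = ksrc (fpth l0 p) by case: hE => -[h _] _; exact: h.
have dd : dlex (p + kdeg mu) fdeg.
  by apply/fdegP; exists (kcomp (fpth l0 p) mu); rewrite // kdeg_comp// h2.
exists mu; split=> //.
have [h3 h4] := hm _ _ (dle_addr p (kdeg mu)) dd.
apply: (@comp_injl _ _ (fpth l0 p)) => //; rewrite -h4 -[in LHS]h2 -kdeg_comp//.
by rewrite hpu.
Qed.

End OfFilter.

Lemma cofinalP : cofinal L <->
  (forall v U, bdfilter U -> exists2 l, U l & vle v (ksrc l)).
Proof.
split=> [h v U hU|h v x hx].
  have [x hx <-] := filter_path hU; have [n [hn hv]] := h v x hx.
  exists (xmor x 0 n); first by exists n.
  by case: hx => hf _; have [_ ->] := xmor_rs hf (dle0 _) hn.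
have [l [n hn ->] hv] := h v _ (pfil_bf hx).
by exists n; split=> //; case: hx hv => hf _; have [_ ->] := xmor_rs hf (dle0 _) hn.
Qed.

(** A shifted path is determined by its initial segments: their degrees give its degree by
    [xdeg_ext], and cancelling one in a longer one gives every other morphism. *)
Lemma xeq_shift x m n : is_degree_functor x -> dlex m (xd x) -> dlex n (xd x) ->
  xeq (xshift m x) (xshift n x) <->
  strip (xmor x 0 m) (pfil x) = strip (xmor x 0 n) (pfil x).
Proof.
move=> hx hm hn.
have half m' n' l : dlex m' (xd x) -> dlex n' (xd x) ->
    xeq (xshift m' x) (xshift n' x) -> strip (xmor x 0 m') (pfil x) l ->
    strip (xmor x 0 n') (pfil x) l.
  move=> hm' hn' [/= h1 h2 h3] /(strip_pfil hx _ hm')[hd hl].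
  apply/(strip_pfil hx) => //.
  have hdn : dlex (n' + kdeg l) (xd x).
    by apply/(dlex_sub _ hn'); rewrite -h1; apply/(dlex_sub _ hm').
  have hdx : dlex (kdeg l) (xsub (xd x) m') by apply/(dlex_sub _ hm').
  by split=> //; have := h3 0 (kdeg l) (dle0 _) hdx; rewrite !addr0 -hl.
split=> [h|h].
  apply/seteqP; split=> l; first exact: half.
  apply: half => //; case: h => /= h1 h2 h3; split=> /=; first by [].
    by move=> p hp; rewrite h2// h1.
  by move=> p q le hq; rewrite h3// h1.
have key p : dlex (m + p) (xd x) ->
    dlex (n + p) (xd x) /\ xmor x m (m + p) = xmor x n (n + p).
  move=> hd.
  have dp : kdeg (xmor x m (m + p)) = p.
    rewrite xmor_deg//; last exact: dle_addr.
    by apply: degP => i; rewrite !degE; lia.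
  have : strip (xmor x 0 m) (pfil x) (xmor x m (m + p)).
    by apply/(strip_pfil hx); rewrite // dp.
  by rewrite h => /(strip_pfil hx _ hn); rewrite dp.
have keyd p : dlex (m + p) (xd x) <-> dlex (n + p) (xd x).
  split=> [/key[]//|hd].
  have dp : kdeg (xmor x n (n + p)) = p.
    rewrite xmor_deg//; last exact: dle_addr.
    by apply: degP => i; rewrite !degE; lia.
  have : strip (xmor x 0 n) (pfil x) (xmor x n (n + p)).
    by apply/(strip_pfil hx); rewrite // dp.
  by rewrite -h => /(strip_pfil hx _ hm); rewrite dp => -[].
have dd : xsub (xd x) m = xsub (xd x) n.
  apply: xdeg_ext => p; apply: iff_trans (dlex_sub _ hm) _.
  by apply: iff_trans (keyd p) _; apply: iff_sym; exact: (dlex_sub _ hn).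
split=> //= p.
  move=> /(dlex_sub _ hm) hp; have [hp' e] := key _ hp.
  have [_ <-] := xmor_rs hx (dle_addr m p) hp.
  by have [_ <-] := xmor_rs hx (dle_addr n p) hp'; rewrite e.
move=> q le /(dlex_sub _ hm) hq.
have lem : dle (m + p) (m + q) by move=> i; rewrite !degE leq_add2l.
have len : dle (n + p) (n + q) by move=> i; rewrite !degE leq_add2l.
have hp := dlex_le lem hq.
have [hp' ep] := key _ hp; have [hq' eq] := key _ hq.
have [r1 r2] := xmor_rs hx (dle_addr m p) hp.
have [r3 r4] := xmor_rs hx (dle_addr n p) hp'.
have [r5 _] := xmor_rs hx lem hq; have [r6 _] := xmor_rs hx len hq'.
move: eq; rewrite (xmor_comp hx (dle_addr m p) lem hq).
rewrite (xmor_comp hx (dle_addr n p) len hq') ep; apply: comp_injl.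
  by rewrite -ep r2 r5.
by rewrite r4 r6.
Qed.

(** The members [a], [b], [c] exist exactly when [dmax m n] is below the degree of the path, so the
    implication encodes the disjunction in the definition. *)
Lemma aperiodicP : aperiodic L <->
  (forall v m n, m <> n -> exists U, [/\ bdfilter U, U (kid L v)
     & forall a b c, U a -> U b -> U c ->
       kdeg a = m -> kdeg b = n -> kdeg c = dmax m n -> strip a U <> strip b U]).
Proof.
split=> h v m n mn; have := h v m n mn.
  move=> [x [hx xv hmn]]; have [hf _] := hx; exists (pfil x); split.
  - exact: pfil_bf.
  - have h0 : dlex 0 (xd x) by move=> i; rewrite degE; case: (xd x i).
    by exists 0; rewrite // -xv; case: hf => _ ->.
  - move=> a b c /pfilP -/(_ hf)[ha ea] /pfilP -/(_ hf)[hb eb] /pfilP -/(_ hf)[hc _].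
    move=> am bn cm; subst m n; case: hmn; first by rewrite -cm.
    by move=> hs e; apply: hs; apply/xeq_shift; rewrite // -ea -eb.
move=> [U [hU Uv hs]]; have [x hx xU] := filter_path hU; have [hf _] := hx.
exists x; split=> //.
  move: Uv; rewrite -xU => /pfilP -/(_ hf)[h0]; rewrite kdeg_id => /(congr1 (@krng _ L)).
  by rewrite krng_id kdeg_id in h0 *; have [-> _] := xmor_rs hf (dle0 _) h0.
apply: contrapT => /not_orP[/contrapT hd /contrapT].
have hm := dlex_le (dle_maxl m n) hd; have hn := dlex_le (dle_maxr m n) hd.
move=> /xeq_shift -/(_ hf hm hn); rewrite xU.
have mem p : dlex p (xd x) -> U (xmor x 0 p) by rewrite -xU => hp; exists p.
exact: hs (mem _ hm) (mem _ hn) (mem _ hd) (xmor0_deg hf hm) (xmor0_deg hf hn)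
  (xmor0_deg hf hd).
Qed.

(* If [mu l] and [nu l] are always compatible then, putting m = d(mu), n = d(nu),
   the components of the minimal extensions have the constant degrees m - n and
   n - m and form finite exhaustive sets, so every boundary filter at [w] is
   shift periodic. *)
Lemma aperiodic_separates mu nu : finitely_aligned L -> aperiodic L ->
  ksrc mu = ksrc nu -> kdeg mu <> kdeg nu ->
  exists2 l, ksrc mu = krng l & ~ compat (kcomp mu l) (kcomp nu l).
Proof.
move=> fa /aperiodicP ap es dmn; apply: contrapT => hno.
have {hno} hall l : ksrc mu = krng l -> compat (kcomp mu l) (kcomp nu l).
  by move=> hl; apply: contrapT => h; apply: hno; exists l.
pose m' := dsub (kdeg mu) (kdeg nu); pose n' := dsub (kdeg nu) (kdeg mu).
have mn' : m' <> n'.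
  move=> e; apply: dmn; apply: degP => i; have /ffunP/(_ i) := e.
  by rewrite !degE; lia.
have [U [hU Uv hs]] := ap (ksrc mu) m' n' mn'.
have rU a : U a -> krng a = ksrc mu by move=> h; rewrite (bf_rng hU h Uv) krng_id.
(* Inside [U], every [l] can be prolonged by degree d(al) - d(be), truncated at 0: the tails on the
   [be] side of the minimal common extensions of [al l] and [be l] form a finite exhaustive set. *)
have step al be l : ksrc al = ksrc mu -> ksrc be = ksrc mu ->
    (forall l, ksrc mu = krng l -> compat (kcomp al l) (kcomp be l)) ->
    U l -> exists2 l', U l' & pre l l' /\ kdeg l' = kdeg l + dsub (kdeg al) (kdeg be).
  move=> sa sb hc ul.
  (* In degree 0 the tails would be vertices, which [FE] excludes; [l] itself serves. *)
  have [d0|dn0] := pselect (dsub (kdeg al) (kdeg be) = 0).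
    by exists l; rewrite // d0 addr0; split=> //; exact: pre_refl.
  have hl := rU _ ul.
  have hal : ksrc al = krng l by rewrite sa hl.
  have hbe : ksrc be = krng l by rewrite sb hl.
  pose E := [fset p.2 | p in lmins (kcomp al l) (kcomp be l)]%fset.
  have EP b : b \in E -> exists a, Lmin (kcomp al l) (kcomp be l) (a, b).
    by move=> /imfsetP[[a b'] /= /(lminsP fa) h ->]; exists a.
  have Ed b : b \in E -> ksrc l = krng b /\ kdeg b = dsub (kdeg al) (kdeg be).
    move=> /EP[a h]; have [_ /= ->] := Lmin_deg h; case: h => /= _.
    rewrite ksrc_comp// => -> _ _; split=> //.
    by rewrite !kdeg_comp//; apply: degP => i; rewrite !degE; lia.
  have hE : FE (ksrc l) E.
    split; last first.
      by apply/negP => /Ed[_ e]; apply: dn0; rewrite -e kdeg_id.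
    split=> [b /Ed[]//|e /esym he].
    have [z] := hc (kcomp l e) (etrans (esym hl) (esym (krng_comp he))).
    rewrite !kcompA// => p1 p2.
    have q1 : pre (kcomp al l) z.
      by apply: pre_trans p1; apply: pre_comp; rewrite ksrc_comp.
    have q2 : pre (kcomp be l) z.
      by apply: pre_trans p2; apply: pre_comp; rewrite ksrc_comp.
    have [x /MCE_Lmin[[a b] hab [_ ex]] px] := MCE_of_ext q1 q2.
    exists b; split; first by apply/imfsetP; exists (a, b) => //; apply/lminsP.
    apply/compat_Lmin; case: (hab) => /= _ hb _ _.
    apply/(@compat_comp _ _ (kcomp be l)) => //; first by rewrite ksrc_comp.
    by exists z => //; rewrite -ex.
  have [b /Ed[hb db] ub] := bf_bd hU ul hE.
  by exists (kcomp l b) => //; split; [exact: pre_comp|rewrite kdeg_comp// db].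
(* Take [r] in [U] beginning with [a e] and with [b], and long enough. A common extension of [al r]
   and [be r] has the prefixes [al b] and [be a] of equal degree, so these agree; comparing what
   follows them, [e] is a prefix of the tail of [r] after [b]. *)
have shift al be : ksrc al = ksrc mu -> ksrc be = ksrc mu ->
    (forall l, ksrc mu = krng l -> compat (kcomp al l) (kcomp be l)) ->
    (forall l, ksrc mu = krng l -> compat (kcomp be l) (kcomp al l)) ->
    forall a b, U a -> U b -> kdeg a = dsub (kdeg al) (kdeg be) ->
    kdeg b = dsub (kdeg be) (kdeg al) -> forall e, strip a U e -> strip b U e.
  move=> sa sb hc hc' a b ua ub da db e [he ue].
  have [r1 ur1 [pr1 dr1]] := step be al _ sb sa hc' ue.
  have [r ur [p1 p2]] := bf_dir hU ur1 ub.
  have [b' hb' er] := p2; have [e' he' er'] := pre_trans pr1 p1.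
  have hr := rU _ ur.
  have [z] := hc r (esym hr).
  have hbr : krng b = ksrc mu by exact: rU.
  have har : krng a = ksrc mu by exact: rU.
  rewrite {1}er er'.
  have h1 : ksrc al = krng b by rewrite sa hbr.
  have h2 : ksrc be = krng a by rewrite sb har.
  have h3 : ksrc e = krng e' by rewrite -he' ksrc_comp.
  have rae : krng (kcomp a e) = krng a by rewrite krng_comp.
  rewrite (kcompA (l := al))// (kcompA (l := be)) ?rae//.
  rewrite (kcompA (l := be) (m := a))//.
  move=> pz1 pz2.
  have s1 : ksrc (kcomp al b) = ksrc b by rewrite ksrc_comp.
  have s2 : ksrc (kcomp be a) = ksrc a by rewrite ksrc_comp.
  have eqab : kcomp al b = kcomp be a.
    have q1 : pre (kcomp al b) z by apply: pre_trans pz1; apply: pre_comp; rewrite s1.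
    have q2 : pre (kcomp be a) z.
      apply: pre_trans pz2; apply: (@pre_trans _ _ (kcomp (kcomp be a) e)).
        by apply: pre_comp; rewrite s2.
      by apply: pre_comp; rewrite ksrc_comp ?s2.
    apply: pre_same q1 q2 _; rewrite !kdeg_comp// da db.
    by apply: degP => i; rewrite !degE; lia.
  have sab : ksrc a = ksrc b by rewrite -s1 -s2 eqab.
  rewrite -eqab in pz2.
  have pe : pre (kcomp (kcomp al b) e) z.
    apply: pre_trans pz2; apply: pre_comp.
    by rewrite ksrc_comp// s1 -sab.
  have hbe : ksrc b = krng e by rewrite -sab.
  have peb : pre e b'.
    apply: (@pre_compl _ _ (kcomp al b)); rewrite ?s1//.
    apply: pre_chain pe pz1 _; rewrite !(kdeg_comp, s1)//.
    have := pre_deg p1; rewrite dr1 er !kdeg_comp// => le i.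
    by have := le i; rewrite !degE da db !degE; lia.
  split=> //; apply: (bf_her hU) ur.
  by rewrite er; exact: pre_compr.
have hall' l : ksrc mu = krng l -> compat (kcomp nu l) (kcomp mu l).
  by move=> /hall/compat_sym.
have U0 := Uv.
have [a ua [_]] := step mu nu _ erefl (esym es) hall U0.
rewrite kdeg_id add0r => da.
have [b ub [_]] := step nu mu _ (esym es) erefl hall' U0.
rewrite kdeg_id add0r => db.
(* The degrees [m'] and [n'] have disjoint supports, so their sum is their maximum. *)
have [c uc [_ dc]] := step nu mu _ (esym es) erefl hall' ua.
apply: (hs a b c ua ub uc da db).
  by rewrite dc da; apply: degP => i; rewrite !degE; lia.
by apply/seteqP; split; [apply: (shift mu nu)|apply: (shift nu mu)].
Qed.

End BoundaryPaths.

(** * Ultrafilters of projections *)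

Section Ultrafilters.
Variables (k : nat) (L : kgraph k).
Hypothesis fa : finitely_aligned L.
Implicit Types (v w : kvert L) (l mu nu a b c : kpath L).

Section Abstract.
Variables (M : zmodType) (q : kpath L -> M -> M) (J : set M).
Hypotheses (qB : forall a m m', q a (m - m') = q a m - q a m')
  (qC : forall a b m, q a (q b m) = q b (q a m))
  (qpre : forall a b m, pre a b -> q a (q b m) = q b m)
  (J0 : J 0) (JB : forall m m', J m -> J m' -> J (m - m'))
  (Jq : forall a m, J m -> J (q a m))
  (Jdir : forall a b m, (forall c, MCE a b c -> J (q c m)) -> J (q a (q b m)))
  (Jbd : forall l E m, FE (ksrc l) E ->
     (forall mu, mu \in E -> J (q (kcomp l mu) m)) -> J (q l m)).

Lemma cut0 a : q a 0 = 0.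
Proof. by rewrite -[X in q a X](subrr 0) qB subrr. Qed.

(** The product of the complements 1 - [q nu], for [nu] in [N], applied to [m]. *)
Definition drops (N : seq (kpath L)) (m : M) : M :=
  foldr (fun nu m => m - q nu m) m N.

Lemma dropsB N m m' : drops N (m - m') = drops N m - drops N m'.
Proof.
elim: N => //= nu N ->.
by rewrite qB !opprB addrACA [RHS]addrACA [X in _ + X = _]addrC.
Qed.

Lemma drops_cut N a m : drops N (q a m) = q a (drops N m).
Proof. by elim: N => //= nu N ->; rewrite qB qC. Qed.

Variables (v : kvert L) (m0 : M).
Hypotheses (nJ : ~ J m0) (q0 : q (kid L v) m0 = m0).

Definition decide nu m := if pselect (J (q nu m)) then m - q nu m else q nu m.

(** Paths are treated in the order of their codes; a number coding no path changes nothing. *)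
Fixpoint uf n := match n with
  | 0%N => m0
  | n'.+1 => if (choice.unpickle n' : option (kpath L)) is Some nu
             then decide nu (uf n') else uf n' end.

Lemma uf_notJ n : ~ J (uf n).
Proof.
elim: n => //= n IH; case: (choice.unpickle n) => // nu.
rewrite /decide; case: pselect => // h h'; apply: IH.
have := JB h' (JB J0 h); rewrite sub0r opprK subrK; exact.
Qed.

Lemma uf_keep a n p : (n <= p)%N -> q a (uf n) = uf n -> q a (uf p) = uf p.
Proof.
elim: p => [|p IH]; first by rewrite leqn0 => /eqP ->.
rewrite leq_eqVlt => /orP[/eqP -> //|lt] e /=; have IHe := IH lt e.
case: (choice.unpickle p) => // nu; rewrite /decide; case: pselect => ? /=.
  by rewrite qB qC IHe.
by rewrite qC IHe.
Qed.

Lemma uf_zero a n p : (n <= p)%N -> q a (uf n) = 0 -> q a (uf p) = 0.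
Proof.
elim: p => [|p IH]; first by rewrite leqn0 => /eqP ->.
rewrite leq_eqVlt => /orP[/eqP -> //|lt] e /=; have IHe := IH lt e.
case: (choice.unpickle p) => // nu; rewrite /decide; case: pselect => ? /=.
  by rewrite qB qC IHe cut0 subrr.
by rewrite qC IHe cut0.
Qed.

(** The accepted paths; by [uf_keep] an acceptance persists at all later stages. *)
Definition ufset : set (kpath L) := [set nu | exists n, q nu (uf n) = uf n].

Lemma qI a m : q a (q a m) = q a m. Proof. by apply: qpre; exact: pre_refl. Qed.

Lemma uf_out nu : ~ ufset nu -> exists n, q nu (uf n) = 0.
Proof.
(* The successor stage is the first one after the decision on [nu]. *)
move=> h; exists (choice.pickle nu).+1 => /=; rewrite choice.pickleK /decide.
case: pselect => hJ; first by rewrite qB qI subrr.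
exfalso; apply: h; exists (choice.pickle nu).+1 => /=; rewrite choice.pickleK /decide.
by case: pselect => //= ?; exact: qI.
Qed.

Lemma uf_outs (s : seq (kpath L)) n0 : (forall nu, nu \in s -> ~ ufset nu) ->
  exists2 n, (n0 <= n)%N & forall nu, nu \in s -> q nu (uf n) = 0.
Proof.
elim: s => [|a s IH] h; first by exists n0.
have [|n le hn] := IH; first by move=> nu hnu; apply: h; rewrite inE hnu orbT.
have [|p hp] := @uf_out a; first by apply: h; rewrite inE eqxx.
exists (maxn n p); first by rewrite leq_max le.
move=> nu; rewrite inE => /predU1P[->|/hn].
  by apply: uf_zero hp; exact: leq_maxr.
by apply: uf_zero; exact: leq_maxl.
Qed.

(** A failure of directedness or of the boundary condition means that finitely many given paths are
    all rejected. At a late stage they all act as 0, and [Jdir] or [Jbd] then puts that stage into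
    [J]. *)
Lemma ufset_bf : bdfilter ufset.
Proof.
split.
- by exists (kid L v); exists 0%N.
- by move=> a b pab [n hn]; exists n; rewrite -{1}hn qpre.
- move=> a b [n hn] [p hp]; apply: contrapT => hno.
  pose s := [seq kcomp a x.1 | x <- lmins a b].
  have sP c : c \in s -> MCE a b c.
    by move=> /mapP[x /(lminsP fa) hx ->]; exact: Lmin_MCE.
  have [|N le hN] := uf_outs (s := s) (maxn n p).
    move=> c /sP/MCE_pre[_ pa pb] hc; apply: hno; exists c => //.
  rewrite geq_max in le; case/andP: le => le1 le2.
  apply: (@uf_notJ N); rewrite -(uf_keep le1 hn) -(uf_keep le2 hp).
  apply: Jdir => c /MCE_Lmin[x hx [-> _]]; rewrite hN//.
  by apply/mapP; exists x => //; apply/lminsP.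
- move=> l E [n hn] hE; apply: contrapT => hno.
  have [|N le hN] := uf_outs (s := [seq kcomp l mu | mu <- E]) n.
    by move=> c /mapP[mu hmu ->] hc; apply: hno; exists mu.
  apply: (@uf_notJ N); rewrite -(uf_keep le hn); apply: (Jbd hE) => mu hmu.
  by rewrite hN ?map_f.
Qed.

(** As all cuts commute, membership in [J] of a cut of [m0] passes to the same cut of every stage.
    At a late stage this cut changes nothing, so the stage itself would lie in [J]. *)
Lemma ultrafilter : exists U, [/\ bdfilter U, U (kid L v)
  & forall l N, U l -> (forall nu, nu \in N -> ~ U nu) -> ~ J (drops N (q l m0))].
Proof.
exists ufset; split; [exact: ufset_bf|by exists 0%N|].
move=> l N [n hn] hN hJ; have [p le hp] := uf_outs n hN.
have {hJ} : J (drops N (q l (uf p))).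
  elim: (p) => //= {hp le}p IH; case: (choice.unpickle p) => // nu.
  rewrite /decide; case: pselect => ? /=.
    by rewrite qB dropsB; apply: JB => //; rewrite qC drops_cut; exact: Jq.
  by rewrite qC drops_cut; exact: Jq.
rewrite (uf_keep le hn) => hJ; apply: (@uf_notJ p).
suff <- : drops N (uf p) = uf p by [].
elim: N hp {hN hJ} => //= nu N IH hp; rewrite IH; last first.
  by move=> a ha; apply: hp; rewrite inE ha orbT.
by rewrite hp ?subr0// inE eqxx.
Qed.

End Abstract.

(* Here [M] is the functions on paths, [q nu] the restriction to the extensions
   of [nu], and [J] the functions with nowhere dense support. *)
Lemma bf_exists v : exists2 U, bdfilter U & U (kid L v).
Proof.
pose q nu (f : kpath L -> int) : kpath L -> int :=
  fun e => if `[<pre nu e>] then f e else 0.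
pose J : set (kpath L -> int) :=
  [set f | forall e, exists2 e', pre e e' & forall z, pre e' z -> f z = 0].
have qE nu f e : pre nu e -> q nu f e = f e by move=> h; rewrite /q asboolT.
have qN nu f e : ~ pre nu e -> q nu f e = 0 by move=> h; rewrite /q asboolF.
have h1 a m m' : q a (m - m') = q a m - q a m'.
  apply: funext => e; rewrite /q /= !fctE.
  by rewrite /= ; case: ifP => //; rewrite subr0.
have [|||||||||U [hU Uv _]] :=
  @ultrafilter _ q J h1 _ _ _ _ _ _ _ v (q (kid L v) (fun=> 1)).
- move=> a b m; apply: funext => e; rewrite /q; case: ifP => //; case: ifP => //.
- move=> a b m pab; apply: funext => e; rewrite /q; case: ifP => //; case: ifP => //.
  by move=> /asboolP h /asboolP; case; exact: pre_trans h.
- by move=> e; exists e => //; exact: pre_refl.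
- move=> m m' h h' e; have [e1 p1 z1] := h e; have [e2 p2 z2] := h' e1.
  exists e2; first exact: pre_trans p2.
  move=> z pz; rewrite !fctE z2// z1 ?subrr//; exact: pre_trans pz.
- move=> a m h e; have [e1 p1 z1] := h e; exists e1 => // z /z1 hz.
  by rewrite /q hz; case: ifP.
- move=> a b m h e.
  have [[e' pe [pa pb]]|hno] := pselect (exists2 e', pre e e' & pre a e' /\ pre b e').
    have [c hc pc] := MCE_of_ext pa pb.
    have [e2 p2 z2] := h c hc e'; exists e2; first exact: pre_trans p2.
    move=> z pz; have := z2 z pz.
    have p' x : pre x e' -> pre x z by move=> h'; apply: pre_trans h' (pre_trans p2 pz).
    by rewrite !qE//; exact: p'.
  exists e => [|z pz]; first exact: pre_refl.
  have [pa|pa] := pselect (pre a z); last by rewrite qN.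
  rewrite qE//; apply: qN => pb; by apply: hno; exists z.
- move=> l E m [[hE1 hE2] _] h e.
  have [[e' pe pl]|hno] := pselect (exists2 e', pre e e' & pre l e').
    have [d hd ed] := pl.
    have [mu [hmu /compat_Lmin cm]] := hE2 d (esym hd).
    have hr := hE1 mu hmu.
    have [e2 pe2 pm2] := (compat_comp hd (esym hr)).2 cm; rewrite -ed in pe2.
    have [e3 p3 z3] := h mu hmu e2.
    exists e3; first exact: pre_trans pe (pre_trans pe2 p3).
    move=> z pz; have := z3 z pz; rewrite !qE//.
      exact: pre_trans pl (pre_trans pe2 (pre_trans p3 pz)).
    exact: pre_trans pm2 (pre_trans p3 pz).
  exists e => [|z pz]; first exact: pre_refl.
  by apply: qN => pl; apply: hno; exists z.
- move=> h; have [e pe he] := h (kid L v).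
  by have := he e (pre_refl e); rewrite qE => // /eqP.
- by apply: funext => e; rewrite /q; case: ifP => // ->.
by exists U.
Qed.

End Ultrafilters.

(** * Kumjian-Pask families *)

Section NonUnital.
Variables (R : comPzRingType) (A : nualg R).
Implicit Types x y z : A.

Lemma numul0l x : (0 : A) ** x = 0.
Proof. by apply: (addIr ((0 : A) ** x)); rewrite -numulDl !add0r. Qed.
Lemma numul0r x : x ** (0 : A) = 0.
Proof. by apply: (addIr (x ** (0 : A))); rewrite -numulDr !add0r. Qed.
Lemma numulNl x y : (- x) ** y = - (x ** y).
Proof. by apply/eqP; rewrite -addr_eq0 -numulDl addNr numul0l. Qed.
Lemma numulNr x y : x ** (- y) = - (x ** y).
Proof. by apply/eqP; rewrite -addr_eq0 -numulDr addNr numul0r. Qed.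
Lemma numulBl x y z : (x - y) ** z = x ** z - y ** z.
Proof. by rewrite numulDl numulNl. Qed.
Lemma numulBr x y z : x ** (y - z) = x ** y - x ** z.
Proof. by rewrite numulDr numulNr. Qed.
Lemma numul_suml I (s : seq I) (P : pred I) (F : I -> A) x :
  (\sum_(i <- s | P i) F i) ** x = \sum_(i <- s | P i) F i ** x.
Proof.
rewrite (big_morph (fun y => y ** x) (id1 := 0) (op1 := +%R))//.
  by move=> y z; rewrite numulDl.
by rewrite numul0l.
Qed.
Lemma numul_sumr I (s : seq I) (P : pred I) (F : I -> A) x :
  x ** (\sum_(i <- s | P i) F i) = \sum_(i <- s | P i) x ** F i.
Proof.
rewrite (big_morph (fun y => x ** y) (id1 := 0) (op1 := +%R))//.
  by move=> y z; rewrite numulDr.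
by rewrite numul0r.
Qed.

End NonUnital.

(** * Relations in a Kumjian-Pask family and its commuting projections *)

Section Family.
Variables (R : comPzRingType) (k : nat) (L : kgraph k).
Hypothesis fa : finitely_aligned L.
Variables (A : nualg R) (S G : kpath L -> A).
Hypothesis h : is_KP_family S G.
Implicit Types (v w : kvert L) (l mu nu a b c : kpath L).

Notation Sv v := (S (kid L v)).

Lemma KP_comp a b : ksrc a = krng b -> S a ** S b = S (kcomp a b).
Proof. by move=> e; case: (KP2 h e). Qed.
Lemma KP_gcomp a b : ksrc a = krng b -> G b ** G a = G (kcomp a b).
Proof. by move=> e; case: (KP2 h e). Qed.
Lemma KP_rS a : Sv (krng a) ** S a = S a.
Proof. by rewrite KP_comp ?ksrc_id// kcomp_idl. Qed.
Lemma KP_Ss a : S a ** Sv (ksrc a) = S a.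
Proof. by rewrite KP_comp ?krng_id// kcomp_idr. Qed.
Lemma KP_Gr a : G a ** Sv (krng a) = G a.
Proof. by rewrite -(KP_ghost_id h) KP_gcomp ?ksrc_id// kcomp_idl. Qed.
Lemma KP_sG a : Sv (ksrc a) ** G a = G a.
Proof. by rewrite -(KP_ghost_id h) KP_gcomp ?krng_id// kcomp_idr. Qed.
Lemma KP_vv v : Sv v ** Sv v = Sv v.
Proof. by rewrite (KP1 h) eqxx. Qed.
Lemma KP_vw v w : v <> w -> Sv v ** Sv w = 0.
Proof. by rewrite (KP1 h); case: eqP. Qed.

Lemma Lmin_self a : Lmin a a = [set (kid L (ksrc a), kid L (ksrc a))].
Proof.
apply/seteqP; split=> [[p1 p2] hp|p /= ->].
  have [/= d1 d2] := Lmin_deg hp; case: hp => /= h1 h2 _ _.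
  have e0 : dsub (kdeg a) (kdeg a) = 0 by apply: degP => i; rewrite !degE; lia.
  by rewrite (deg0_id (etrans d1 e0)) (deg0_id (etrans d2 e0)) -h1 -h2.
split; rewrite /= ?krng_id// kcomp_idr; apply/MCE_pre.
by split; rewrite ?dmax_same//; exact: pre_refl.
Qed.

Lemma KP_GS a : G a ** S a = Sv (ksrc a).
Proof. by rewrite (KP3 h) Lmin_self fsbig_set1 /= (KP_ghost_id h) KP_vv. Qed.

Lemma KP_GS0 a b : ~ compat a b -> G a ** S b = 0.
Proof.
move=> hc; rewrite (KP3 h); suff -> : Lmin a b = set0 by rewrite fsbig_set0.
apply/seteqP; split=> p // hp; case: hc.
by apply/compat_Lmin; exists p.
Qed.

Lemma KP_GSpre a c : ksrc a = krng c -> G a ** S (kcomp a c) = S c.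
Proof. by move=> e; rewrite -KP_comp// numulA KP_GS e KP_rS. Qed.
Lemma KP_GpreS a c : ksrc a = krng c -> G (kcomp a c) ** S a = G c.
Proof. by move=> e; rewrite -KP_gcomp// -numulA KP_GS e KP_Gr. Qed.

Lemma KP_SG0 a b : ksrc a <> ksrc b -> S a ** G b = 0.
Proof.
move=> ne; rewrite -(KP_Ss a) -(KP_sG b) numulA -(numulA (S a)).
by rewrite KP_vw// numul0r numul0l.
Qed.
Lemma KP_SS0 a b : ksrc a <> krng b -> S a ** S b = 0.
Proof.
move=> ne; rewrite -(KP_Ss a) -(KP_rS b) numulA -(numulA (S a)).
by rewrite KP_vw// numul0r numul0l.
Qed.

(** The instance of the abstract [q] above; acting on the right, it preserves every right ideal. *)
Definition rcut a (x : A) := x ** (S a ** G a).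

Lemma rcutB a x y : rcut a (x - y) = rcut a x - rcut a y.
Proof. exact: numulBl. Qed.

(** (KP3) gives a sum over pairs, and [p] to [a p.1] is a bijection from [Lmin a b] to [MCE a b].
    The result is symmetric in [a] and [b], whence [rcutC]. *)
Lemma proj_mul a b : (S a ** G a) ** (S b ** G b) = \sum_(c \in MCE a b) (S c ** G c).
Proof.
have fin : finite_set (Lmin a b) := fa a b.
have -> : \sum_(c \in MCE a b) (S c ** G c) =
    \sum_(p \in Lmin a b) (S (kcomp a p.1) ** G (kcomp b p.2)).
  rewrite (@reindex_fsbig _ _ _ _ _ (fun p => kcomp a p.1) (Lmin a b)).
    by apply: eq_fsbigr => p /set_mem[_ _ -> _].
  split.
  - by move=> p /Lmin_MCE.
  - move=> p q /set_mem hp /set_mem hq e; apply: (Lmin_uniq hp hq (pre_refl _)).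
    by rewrite -e; exact: pre_refl.
  - by move=> c /MCE_Lmin[p hp [e _]]; exists p.
rewrite numulA -(numulA (S a)) (KP3 h) !fsbig_finite// numul_sumr numul_suml.
rewrite !big_seq; apply: eq_bigr => p; rewrite in_fset_set// => /set_mem[h1 h2 _ _].
by rewrite -KP_comp// -KP_gcomp// !numulA.
Qed.

Lemma MCEC a b : MCE a b = MCE b a.
Proof.
apply/seteqP; split=> c /MCE_pre[d p1 p2]; apply/MCE_pre; split=> //;
  by rewrite dmaxC.
Qed.

Lemma rcutC a b x : rcut a (rcut b x) = rcut b (rcut a x).
Proof. by rewrite /rcut -[LHS]numulA -[RHS]numulA !proj_mul MCEC. Qed.

Lemma rcut_pre a b x : pre a b -> rcut a (rcut b x) = rcut b x.
Proof.
move=> [c hc ->]; rewrite /rcut -numulA; congr (_ ** _).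
by rewrite numulA -(numulA _ _ (S a)) KP_GpreS// -numulA KP_gcomp.
Qed.

Lemma rcut_SG a b : rcut b (S a ** G b) = S a ** G b.
Proof.
have [e|ne] := eqVneq (ksrc a) (ksrc b); last first.
  by rewrite KP_SG0 ?/rcut ?numul0l//; apply/eqP.
by rewrite /rcut -numulA (numulA (G b)) KP_GS KP_sG.
Qed.

Section Ideal.
Variable J : set A.
Hypotheses (J0 : J 0) (JB : forall x y, J x -> J y -> J (x - y))
  (Jq : forall a x, J x -> J (rcut a x)).

Lemma subgroupD x y : J x -> J y -> J (x + y).
Proof. by move=> jx jy; have := JB jx (JB J0 jy); rewrite sub0r opprK. Qed.

Lemma rcut_dir a b x : (forall c, MCE a b c -> J (rcut c x)) -> J (rcut a (rcut b x)).
Proof.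
move=> hJ; rewrite rcutC /rcut -numulA proj_mul.
have fin : finite_set (MCE a b).
  apply: (sub_finite_set _ (finite_image (fun p => kcomp a p.1) (fa a b))).
  by move=> c /MCE_Lmin[p hp [e _]]; exists p.
rewrite fsbig_finite// numul_sumr big_seq; apply: (big_ind J) => //; first exact: subgroupD.
by move=> c; rewrite in_fset_set// => /set_mem; exact: hJ.
Qed.

(** Transported along [S l], the product in (KP4) becomes that of the complements of the cuts at
    [l mu], which therefore kills the cut at [l]. Undoing the factors one by one changes that cut
    only by elements of [J]. *)
Lemma rcut_bd l (E : {fset kpath L}) x : FE (ksrc l) E ->
  (forall mu, mu \in E -> J (rcut (kcomp l mu) x)) -> J (rcut l x).
Proof.
move=> hE hJ; pose f (y : A) mu := y - rcut (kcomp l mu) y.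
have hr mu : mu \in E -> ksrc l = krng mu by case: hE => -[hE _] _ /hE.
have key (s : seq (kpath L)) y : {subset s <= E} ->
    y ** S l ** \big[@numul R A / Sv (ksrc l)]_(mu <- s) (Sv (ksrc l) - S mu ** G mu)
    = foldl f y s ** S l.
  elim: s y => [|mu s IH] y sub /=; first by rewrite big_nil -numulA KP_Ss.
  rewrite -IH; last by move=> z hz; apply: sub; rewrite inE hz orbT.
  have hmu : ksrc l = krng mu by apply: hr; apply: sub; rewrite inE eqxx.
  rewrite big_cons [LHS]numulA; congr (_ ** _).
  rewrite numulBr -numulA KP_Ss /f numulBl /rcut; congr (_ - _).
  rewrite -!numulA; congr (_ ** _).
  by rewrite KP_GpreS// numulA KP_comp.
have key2 (s : seq (kpath L)) y : (forall mu, mu \in s -> J (rcut (kcomp l mu) y)) ->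
    J (rcut l (foldl f y s)) -> J (rcut l y).
  elim: s y => [|mu s IH] y //= hs hf.
  have hmu : J (rcut (kcomp l mu) y) by apply: hs; rewrite inE eqxx.
  have : J (rcut l (f y mu)).
    apply: IH hf => nu hnu; rewrite /f rcutB; apply: JB; last by apply: Jq.
    by apply: hs; rewrite inE hnu orbT.
  by rewrite /f rcutB => hd; have := subgroupD hd (Jq l hmu); rewrite subrK.
apply: (key2 E) => //; rewrite /rcut numulA -key// (KP4 h hE).
by rewrite numul0r numul0l.
Qed.

Lemma KP_ultrafilter v x : x ** Sv v = x -> ~ J x ->
  exists U, [/\ bdfilter U, U (kid L v)
  & forall l N, U l -> (forall nu, nu \in N -> ~ U nu) ->
     ~ J (drops rcut N (rcut l x))].
Proof.
move=> ev nJ.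
apply: (ultrafilter fa rcutB rcutC rcut_pre J0 JB Jq rcut_dir rcut_bd nJ).
by rewrite /rcut (KP_ghost_id h) KP_vv.
Qed.

End Ideal.

Lemma drops_fixed b N x : rcut b x = x -> b \in N -> drops rcut N x = 0.
Proof.
move=> e; elim: N => //= a N IH; rewrite inE => /predU1P[<-|/IH ->].
  by rewrite -(drops_cut rcutB rcutC) e subrr.
by rewrite /rcut numul0l subrr.
Qed.

End Family.

(** * The elements s_a s_b^* span the algebra *)

Section Span.
Variables (R : comPzRingType) (k : nat) (L : kgraph k).
Hypothesis fa : finitely_aligned L.
Implicit Types (v w : kvert L) (l mu nu a b c : kpath L).

Notation A := (KP R L).
Notation S := (@kps R k L).
Notation G := (@kpg R k L).
Notation Sv v := (kps R (kid L v)).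
Let h : is_KP_family S G := kp_family R fa.

Inductive kpspan : A -> Prop :=
| kpspan0 : kpspan 0
| kpspanD (r : R) a b x : ksrc a = ksrc b -> kpspan x ->
    kpspan (r *: (S a ** G b) + x).

Lemma kpspan_add x y : kpspan x -> kpspan y -> kpspan (x + y).
Proof.
by move=> hx hy; elim: hx => [|r a b z e _ IH]; rewrite ?add0r// -addrA; apply: kpspanD.
Qed.

Lemma kpspan_gen a b : kpspan (S a ** G b).
Proof.
have [e|/eqP ne] := eqVneq (ksrc a) (ksrc b); last first.
  by rewrite (KP_SG0 h ne); exact: kpspan0.
by rewrite -[_ ** _]scale1r -[_ *: _]addr0; apply: kpspanD => //; exact: kpspan0.
Qed.

Lemma kpspan_scale r x : kpspan x -> kpspan (r *: x).
Proof.
elim=> [|s a b z e _ IH]; first by rewrite scaler0; exact: kpspan0.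
by rewrite scalerDr scalerA; exact: kpspanD.
Qed.

Lemma kpspan_lin (f : A -> A) : (forall x y, f (x + y) = f x + f y) ->
  (forall r x, f (r *: x) = r *: f x) ->
  (forall a b, ksrc a = ksrc b -> kpspan (f (S a ** G b))) ->
  forall x, kpspan x -> kpspan (f x).
Proof.
move=> fD fZ fg x; elim=> [|s a b z e _ IH].
  by rewrite -(scale0r 0) fZ scale0r; exact: kpspan0.
by rewrite fD fZ; apply: kpspan_add => //; apply: kpspan_scale; exact: fg.
Qed.

Lemma kpspan_S l x : kpspan x -> kpspan (S l ** x).
Proof.
apply: kpspan_lin => [y z|r y|a b e]; [exact: numulDr|exact: numulZr|].
rewrite numulA; have [el|/eqP ne] := eqVneq (ksrc l) (krng a).
  by rewrite (KP_comp h el); exact: kpspan_gen.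
by rewrite (KP_SS0 h ne) numul0l; exact: kpspan0.
Qed.

Lemma kpspan_G l x : kpspan x -> kpspan (G l ** x).
Proof.
apply: kpspan_lin => [y z|r y|a b e]; [exact: numulDr|exact: numulZr|].
rewrite numulA (KP3 h) fsbig_finite; last exact: fa.
rewrite numul_suml big_seq; apply: big_ind; first exact: kpspan0.
  exact: kpspan_add.
move=> p; rewrite in_fset_set; last exact: fa.
move=> /set_mem[h1 h2 _ _]; rewrite -numulA (KP_gcomp h) -?e//.
exact: kpspan_gen.
Qed.

Lemma kpclass_mul (t u : kpterm R L) :
  kpclass (TMul t u) = (kpclass t : A) ** (kpclass u : A).
Proof. by apply: kpcar_ext => B T H hT; rewrite kpval_mul// !kpval_class. Qed.
Lemma kpclass_add (t u : kpterm R L) :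
  kpclass (TAdd t u) = (kpclass t : A) + (kpclass u : A).
Proof. by apply: kpcar_ext => B T H hT; rewrite kpval_add// !kpval_class. Qed.
Lemma kpclass_scale r (t : kpterm R L) :
  kpclass (TScale r t) = r *: (kpclass t : A).
Proof. by apply: kpcar_ext => B T H hT; rewrite kpval_scale// !kpval_class. Qed.
Lemma kpclass_repr (x : A) : x = kpclass (kprep x).
Proof. by rewrite /kpclass /kprep reprK. Qed.

(** It suffices to multiply by generators; for ghosts, (KP3) rewrites s_l^* s_a as a finite sum. *)
Lemma kpspan_mul (t : kpterm R L) x : kpspan x -> kpspan ((kpclass t : A) ** x).
Proof.
elim: t x => [l|l||t IHt u IHu|r t IH|t IHt u IHu] x hx.
- exact: kpspan_S.
- exact: kpspan_G.
- have -> : (kpclass (TZero R L) : A) = 0 by [].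
  by rewrite numul0l; exact: kpspan0.
- by rewrite kpclass_add numulDl; apply: kpspan_add; auto.
- by rewrite kpclass_scale numulZl; apply: kpspan_scale; auto.
- by rewrite kpclass_mul -numulA; auto.
Qed.

Lemma kpspanT x : kpspan x.
Proof.
rewrite (kpclass_repr x); elim: (kprep x) => [l|l||t IHt u IHu|r t IH|t IHt u IHu].
- have -> : (kpclass (TGen R l) : A) = S l ** G (kid L (ksrc l)).
    by rewrite (KP_ghost_id h) (KP_Ss h).
  exact: kpspan_gen.
- have -> : (kpclass (TGhost R l) : A) = S (kid L (ksrc l)) ** G l by rewrite (KP_sG h).
  exact: kpspan_gen.
- exact: kpspan0.
- by rewrite kpclass_add; exact: kpspan_add.
- by rewrite kpclass_scale; exact: kpspan_scale.
- by rewrite kpclass_mul; exact: kpspan_mul.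
Qed.

Lemma kp_terms (x : A) : exists s : seq (R * (kpath L * kpath L)),
  x = \sum_(t <- s) t.1 *: (S t.2.1 ** G t.2.2).
Proof.
elim: (kpspanT x) => [|r a b y _ _ [s ->]]; first by exists [::]; rewrite big_nil.
by exists ((r, (a, b)) :: s); rewrite big_cons.
Qed.

End Span.

(** * Compressing a nonzero element to a vertex idempotent *)

Section Spanned.
Variables (R : comPzRingType) (k : nat) (L : kgraph k).
Hypothesis fa : finitely_aligned L.
Variables (A : nualg R) (S G : kpath L -> A).
Hypothesis h : is_KP_family S G.
Hypothesis terms : forall x : A, exists s : seq (R * (kpath L * kpath L)),
  x = \sum_(t <- s) t.1 *: (S t.2.1 ** G t.2.2).
Implicit Types (v w : kvert L) (l mu nu a b c : kpath L).

Notation Sv v := (S (kid L v)).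

(** The sum of the idempotents at the ranges of the ghost paths in an expansion of [x] is a right
    unit for [x]. *)
Lemma right_unit (x : A) : x <> 0 -> exists v, x ** Sv v <> 0.
Proof.
move=> nx; apply: contrapT => hno; apply: nx.
have {}hno v : x ** Sv v = 0 by apply: contrapT => h'; apply: hno; exists v.
have [s es] := terms x.
pose V := undup [seq krng t.2.2 | t <- s].
have -> : x = x ** \sum_(v <- V) Sv v.
  rewrite {1 2}es numul_suml; apply: eq_big_seq => t ht.
  rewrite numulZl -numulA; congr (_ *: (_ ** _)).
  rewrite numul_sumr (bigD1_seq (krng t.2.2)) ?undup_uniq//; last first.
    by rewrite mem_undup; apply: map_f.
  rewrite (KP_Gr h) big1; first exact: esym (addr0 _).
  move=> v /eqP ne.
  by rewrite -(KP_Gr h) -numulA (KP_vw h) ?numul0r//; exact/nesym.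
by rewrite numul_sumr big1.
Qed.

Lemma collect (s : seq (R * kpath L)) : exists (T : seq (kpath L)) (f : kpath L -> R),
  [/\ uniq T, forall t, t \in T -> t \in map snd s /\ f t <> 0
    & \sum_(i <- s) i.1 *: S i.2 = \sum_(t <- T) f t *: S t].
Proof.
pose f t := \sum_(i <- s | i.2 == t) i.1.
pose T := [seq t <- undup (map snd s) | f t != 0].
exists T, f; split.
- exact/filter_uniq/undup_uniq.
- by move=> t; rewrite mem_filter mem_undup => /andP[/eqP].
rewrite big_filter [RHS]big_mkcond.
rewrite [RHS](eq_bigr (fun t =>
  \sum_(i <- s) if i.2 == t then i.1 *: S i.2 else 0)); last first.
  move=> t _; transitivity (f t *: S t).
    by case: (eqVneq (f t) 0) => [->|//]; rewrite scale0r.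
  rewrite /f scaler_suml big_mkcond; apply: eq_bigr => i _.
  by case: (eqVneq i.2 t) => // ->.
rewrite [RHS]exchange_big; apply: eq_big_seq => i hi.
rewrite (bigD1_seq i.2) ?undup_uniq ?mem_undup ?map_f// eqxx big1.
  exact: esym (addr0 _).
by move=> t; rewrite eq_sym => /negbTE ->.
Qed.

(** Expand [x], cut to a vertex, along an ultrafilter [U] for [J] = 0. Terms whose ghost path lies
    in [U] become combinations of real paths after a long enough [l] in [U]; the other ghost paths
    are incompatible with [l e] for the [e] given by [bf_avoid], so their terms vanish. *)
Lemma normal_form (x : A) : x <> 0 -> exists l e (T : seq (kpath L)) f,
  [/\ uniq T, T != [::], forall t, t \in T -> ksrc t = krng e /\ f t <> 0
    & x ** S l = (\sum_(t <- T) f t *: S t) ** S e].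
Proof.
move=> /right_unit[v nx].
pose y := x ** Sv v; have ey : y ** Sv v = y by rewrite -numulA (KP_vv h).
have [U [hU Uv hN]] := @KP_ultrafilter R k L fa A S G h [set 0] erefl
  (fun (p q : A) (ha : p = 0) (hb : q = 0) =>
     etrans (congr2 (fun p q => p - q) ha hb) (subr0 0))
  (fun a (p : A) (hb : p = 0) => etrans (congr1 (rcut S G a) hb) (numul0l _)) v y ey nx.
have [s es] := terms y.
have [l [ul _ hl]] := bf_sup hU [seq t.2.2 | t <- s] Uv.
pose N := [seq b <- [seq t.2.2 | t <- s] | ~~ `[<U b>]].
have hNU nu : nu \in N -> ~ U nu by rewrite mem_filter => /andP[/asboolP].
have [e he hinc] := bf_avoid (N := seq_fset tt N) hU fa ul
  (fun nu hnu => hNU nu (etrans (esym (seq_fsetE tt N nu)) hnu)).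
pose P (t : R * (kpath L * kpath L)) := `[<U t.2.2>].
pose yU := \sum_(t <- s | P t) t.1 *: (S t.2.1 ** G t.2.2).
pose yN := \sum_(t <- s | ~~ P t) t.1 *: (S t.2.1 ** G t.2.2).
have yE : y = yU + yN by rewrite es (bigID P).
have rl : krng l = v by rewrite (bf_rng hU ul Uv) krng_id.
have yN0 : yN ** S (kcomp l e) = 0.
  rewrite numul_suml big_seq_cond big1// => t /andP[ht hPt].
  rewrite numulZl -numulA (KP_GS0 h) ?numul0r ?scaler0//.
  move=> /compat_sym; apply: hinc; rewrite seq_fsetE mem_filter -/(P t) hPt /=.
  by apply/mapP; exists t.
have dl a z z' : rcut S G a (z - z') = rcut S G a z - rcut S G a z' by exact: rcutB.
have rC : forall a b z, rcut S G a (rcut S G b z) = rcut S G b (rcut S G a z).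
  exact: rcutC.
(* Each term of [yN] is fixed by the cut at its own ghost path, hence killed by that complement. *)
have yNd : drops (rcut S G) N yN = 0.
  have d0 : drops (rcut S G) N 0 = 0 by have := dropsB dl N 0 0; rewrite !subrr.
  have dD z z' : drops (rcut S G) N (z + z') =
      drops (rcut S G) N z + drops (rcut S G) N z'.
    by rewrite -[in LHS](opprK z') (dropsB dl) -[- z']sub0r (dropsB dl) d0 sub0r opprK.
  rewrite (big_morph _ dD d0) big_seq_cond big1// => t /andP[ht hPt].
  apply: (drops_fixed fa h (b := t.2.2)).
    by rewrite /rcut numulZl -/(rcut S G _ _) (rcut_SG h).
  by rewrite mem_filter -/(P t) hPt; apply/mapP; exists t.
(* Otherwise the cut of [y] at [l] is that of [yN], which the complements kill, against the choice
   of [U]. *)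
have nP : yU ** S l <> 0.
  move=> e0; apply: (hN l N ul hNU).
  have -> : rcut S G l y = rcut S G l yU + rcut S G l yN by rewrite yE /rcut numulDl.
  have -> : rcut S G l yU = 0 by rewrite /rcut numulA e0 numul0l.
  rewrite add0r (drops_cut dl rC) yNd /rcut; exact: numul0l.
have [s' hs' es'] : exists2 s' : seq (R * kpath L),
    forall i, i \in s' -> ksrc i.2 = ksrc l & yU ** S l = \sum_(i <- s') i.1 *: S i.2.
  rewrite /yU numul_suml big_seq_cond.
  apply: (big_ind (fun z => exists2 s' : seq (R * kpath L),
    forall i, i \in s' -> ksrc i.2 = ksrc l & z = \sum_(i <- s') i.1 *: S i.2)).
  - by exists [::]; rewrite ?big_nil.
  - move=> _ _ [s1 h1 ->] [s2 h2 ->]; exists (s1 ++ s2); last by rewrite big_cat.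
    by move=> i; rewrite mem_cat => /orP[/h1|/h2].
  - move=> t /andP[ht /asboolP hPt].
    have [c hc ec] : pre t.2.2 l by apply: hl => //; apply/mapP; exists t.
    rewrite numulZl -numulA ec (KP_GSpre h hc).
    have [ea|ne] := eqVneq (ksrc t.2.1) (krng c).
      exists [:: (t.1, kcomp t.2.1 c)]; last by rewrite big_seq1 (KP_comp h ea).
      by move=> i; rewrite inE => /eqP -> /=; rewrite !ksrc_comp.
    by exists [::] => //; rewrite big_nil (KP_SS0 h) ?scaler0//; apply/eqP.
have [T [f [uT hT eT]]] := collect s'.
have rle : krng (kcomp l e) = v by rewrite krng_comp.
exists (kcomp l e), e, T, f; split=> //.
- by apply/eqP => T0; apply: nP; rewrite es' eT T0 big_nil.
- by move=> t /hT[/mapP[i hi ->] nf]; split=> //; rewrite (hs' _ hi).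
rewrite -eT -es' -numulA (KP_comp h he).
have <- : y ** S (kcomp l e) = yU ** S (kcomp l e) by rewrite yE numulDl yN0 addr0.
by rewrite /y -numulA -rle (KP_rS h).
Qed.

(** Induction on [T]. Distinct paths of equal degree are incompatible from the start; for different
    degrees aperiodicity is applied to [t0 l] and [t l]. Prolonging [l] keeps the incompatibilities
    already obtained. *)
Lemma separate_list w (T : seq (kpath L)) t0 : aperiodic L ->
  ksrc t0 = w -> (forall t, t \in T -> ksrc t = w) ->
  exists2 l, krng l = w &
    forall t, t \in T -> t <> t0 -> ~ compat (kcomp t0 l) (kcomp t l).
Proof.
move=> ap e0; elim: T => [|t T IH] hT.
  by exists (kid L w) => //; rewrite krng_id.
have [|l hl IHl] := IH; first by move=> u hu; apply: hT; rewrite inE hu orbT.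
have et : ksrc t = w by apply: hT; rewrite inE eqxx.
have h0l : ksrc t0 = krng l by rewrite e0.
have htl : ksrc t = krng l by rewrite et.
have more m : ksrc l = krng m -> forall u, ksrc u = w ->
    compat (kcomp t0 (kcomp l m)) (kcomp u (kcomp l m)) ->
    compat (kcomp t0 l) (kcomp u l).
  move=> hm u hu [z p1 p2]; exists z.
    by apply: pre_trans p1; apply: pre_compr => //; exact: pre_comp.
  by apply: pre_trans p2; apply: pre_compr; [rewrite hu|exact: pre_comp].
have [ed|nd] := pselect (kdeg t0 = kdeg t).
  exists l => // u; rewrite inE => /predU1P[-> ne [z p1 p2]|]; last exact: IHl.
  apply: ne; apply: (pre_same (l := z)) => //.
    by apply: pre_trans p2; exact: pre_comp.
  by apply: pre_trans p1; exact: pre_comp.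
have [|d|m hm nm] := aperiodic_separates fa ap (mu := kcomp t0 l) (nu := kcomp t l).
- by rewrite !ksrc_comp.
- by apply: nd; move: d; rewrite !kdeg_comp// => /deg_addIl.
rewrite ksrc_comp// in hm.
exists (kcomp l m); first by rewrite krng_comp.
move=> u; rewrite inE => /predU1P[-> _|hu ne]; first by rewrite !kcompA.
move=> hc; apply: (IHl u hu ne); apply: (more m hm u) => //.
by apply: hT; rewrite inE hu orbT.
Qed.

(** With [m] separating the paths [t e], left multiplication by the ghost of [t0 e m] kills every
    term of the normal form except that of [t0], whose coefficient is invertible. *)
Lemma compress (x : A) : is_field R -> aperiodic L -> x <> 0 ->
  exists y z w, y ** x ** z = Sv w.
Proof.
move=> [_ hinv] ap /normal_form[l [e [T [f [uT nT hT eT]]]]].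
case: T uT nT hT eT => // t0 T /= /andP[t0T uT] _ hT eT.
have [e0 f0] := hT t0 (mem_head _ _).
have {}hT t : t \in T -> ksrc t = krng e.
  by move=> ht; case: (hT t) => //; rewrite inE ht orbT.
have [m hm sep] := separate_list (w := ksrc e) (T := [seq kcomp t e | t <- T])
  (t0 := kcomp t0 e) ap (ksrc_comp e0)
  (fun u hu => let: ex_intro2 t ht eu := mapP hu in
     etrans (congr1 _ eu) (ksrc_comp (hT t ht))).
have [r hr] := hinv _ f0.
have ht0 : ksrc (kcomp t0 e) = krng m by rewrite ksrc_comp.
exists (r *: G (kcomp (kcomp t0 e) m)), (S l ** S m), (ksrc m).
have E : x ** (S l ** S m) = (\sum_(t <- t0 :: T) f t *: S t) ** S (kcomp e m).
  by rewrite numulA eT -numulA (KP_comp h (esym hm)).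
rewrite -(numulA _ x) E numulZl big_cons numulDl numulDr numulZl numulZr.
rewrite (KP_comp h) ?krng_comp// kcompA// (KP_GS h) ksrc_comp//.
rewrite numul_suml numul_sumr big_seq big1 ?addr0; last first.
  move=> t ht; rewrite numulZl numulZr (KP_comp h) ?krng_comp ?(hT _ ht)//.
  rewrite (kcompA (hT _ ht) (esym hm)) (KP_GS0 h) ?scaler0//.
  apply: sep; first by apply/mapP; exists t.
  move=> ee; have := comp_injr (hT t ht) e0 ee => et.
  by rewrite -et ht in t0T.
by rewrite scalerA mulrC hr scale1r.
Qed.

End Spanned.

(** * The representation on boundary filters *)

Section Endomorphisms.
Variables (R : comPzRingType) (V : lmodType R).

Definition lpred : {pred (V -> V)} := fun f =>
  `[< (forall x y, f (x + y) = f x + f y) /\ forall (r : R) x, f (r *: x) = r *: f x >].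

Lemma lpred_closed : submod_closed lpred.
Proof.
split=> [|r f g /asboolP[fD fZ] /asboolP[gD gZ]].
  by apply/asboolP; split=> [x y|r x]; [rewrite [RHS]addr0|rewrite [RHS]scaler0].
apply/asboolP; split=> [x y|s x]; rewrite !fctE.
  by rewrite fD gD scalerDr addrACA.
by rewrite fZ gZ scalerDr !scalerA mulrC.
Qed.
HB.instance Definition _ :=
  GRing.isSubmodClosed.Build R (V -> V) lpred lpred_closed.

Record lend := Lend { lfun :> V -> V; lfunP : lfun \in lpred }.
HB.instance Definition _ := [isSub for lfun].
HB.instance Definition _ := [Choice of lend by <:].
HB.instance Definition _ := [SubChoice_isSubLmodule of lend by <:].

Lemma lend_lin (f : lend) : (forall x y, f (x + y) = f x + f y) /\
  forall (r : R) x, f (r *: x) = r *: f x.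
Proof. by case: f => f /= /asboolP. Qed.

Lemma lend_ext (f g : lend) : (forall x, f x = g x) -> f = g.
Proof. by move=> e; apply: val_inj; apply: funext. Qed.

Fact lmul_subproof (f g : lend) : (f \o g) \in lpred.
Proof.
case: (lend_lin f) (lend_lin g) => fD fZ [gD gZ].
by apply/asboolP; split=> [x y|r x] /=; rewrite ?gD ?gZ.
Qed.
Definition lmul f g := Lend (lmul_subproof f g).

Definition lendA : nualg R.
Proof.
apply: (@NUAlg R lend lmul).
- by move=> f g h; apply: lend_ext.
- by move=> f g h; apply: lend_ext.
- move=> f g h; apply: lend_ext => x.
  by case: (lend_lin f) => fD _; exact: fD.
- by move=> r f g; apply: lend_ext.
- move=> r f g; apply: lend_ext => x.
  by case: (lend_lin f) => _ fZ; exact: fZ.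
Defined.

End Endomorphisms.

Section Representation.
Variables (R : comPzRingType) (k : nat) (L : kgraph k).
Hypothesis fa : finitely_aligned L.
Implicit Types (v w : kvert L) (l mu nu a b : kpath L).

Definition grade := {ffun 'I_k -> int}.
Definition zdeg l : grade := [ffun i => (kdeg l i)%:Z].
Definition point := (set (kpath L) * grade)%type.
Definition fspace := (point -> R^o).

(* [c] is either 0 or [zdeg]; the latter remembers the grading of the algebra. *)
Variables (X : set (set (kpath L))) (c : kpath L -> grade).
Hypotheses (XB : forall U, X U -> bdfilter U)
  (Xstrip : forall U l, X U -> U l -> X (strip l U))
  (Xprep : forall U l, X U -> U (kid L (ksrc l)) -> X (prep l U))
  (c0 : forall v, c (kid L v) = 0)
  (cD : forall l m, ksrc l = krng m -> c (kcomp l m) = c l + c m).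

(** On indicators of points with filter in [X], [opS l] is concatenation with [l] (where
    composable), raising the grade by [c l], and [opG l] is removal of the prefix [l], lowering
    it. *)
Definition opS l (f : fspace) : fspace := fun p =>
  if `[< X p.1 /\ p.1 l >] then f (strip l p.1, p.2 - c l) else 0.
Definition opG l (f : fspace) : fspace := fun p =>
  if `[< X p.1 /\ p.1 (kid L (ksrc l)) >] then f (prep l p.1, p.2 + c l) else 0.

Fact opS_subproof l : opS l \in @lpred R fspace.
Proof.
apply/asboolP; split=> [x y|r x]; apply: funext => p; rewrite /opS !fctE;
  by case: ifP => _; rewrite ?addr0 ?scaler0.
Qed.
Fact opG_subproof l : opG l \in @lpred R fspace.
Proof.
apply/asboolP; split=> [x y|r x]; apply: funext => p; rewrite /opG !fctE;
  by case: ifP => _; rewrite ?addr0 ?scaler0.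
Qed.
Definition repS l : lendA fspace := Lend (opS_subproof l).
Definition repG l : lendA fspace := Lend (opG_subproof l).

Notation E := (lendA fspace).
Definition ev (x : E) : fspace -> fspace := lfun x.

Lemma evM (x y : E) f : ev (x ** y) f = ev x (ev y f). Proof. by []. Qed.
Lemma evB (x y : E) f p : ev (x - y) f p = ev x f p - ev y f p. Proof. by []. Qed.
Lemma ev0 f p : ev 0 f p = 0. Proof. by []. Qed.
Lemma ev_sum I (s : seq I) (F : I -> E) f p :
  ev (\sum_(i <- s) F i) f p = \sum_(i <- s) ev (F i) f p.
Proof. by elim: s => [|i s IH]; rewrite ?big_nil// !big_cons -IH. Qed.
Lemma ev_ext (x y : E) : (forall f U g, X U -> ev x f (U, g) = ev y f (U, g)) ->
  (forall f U g, ~ X U -> ev x f (U, g) = 0) ->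
  (forall f U g, ~ X U -> ev y f (U, g) = 0) -> x = y.
Proof.
move=> h1 h2 h3; apply: lend_ext => f; apply: funext => -[U g].
by have [/h1|nX] := pselect (X U); [exact|rewrite -/(ev x) -/(ev y) h2// h3].
Qed.

Lemma evS l f U g : X U -> U l -> ev (repS l) f (U, g) = f (strip l U, g - c l).
Proof. by move=> hX hl; rewrite /ev /= /opS asboolT. Qed.
Lemma evS0 l f U g : ~ (X U /\ U l) -> ev (repS l) f (U, g) = 0.
Proof. by move=> hX; rewrite /ev /= /opS asboolF. Qed.
Lemma evG l f U g : X U -> U (kid L (ksrc l)) ->
  ev (repG l) f (U, g) = f (prep l U, g + c l).
Proof. by move=> hX hl; rewrite /ev /= /opG asboolT. Qed.
Lemma evG0 l f U g : ~ (X U /\ U (kid L (ksrc l))) -> ev (repG l) f (U, g) = 0.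
Proof. by move=> hX; rewrite /ev /= /opG asboolF. Qed.
Lemma evS_out l f U g : ~ X U -> ev (repS l) f (U, g) = 0.
Proof. by move=> nX; apply: evS0 => -[]. Qed.
Lemma evG_out l f U g : ~ X U -> ev (repG l) f (U, g) = 0.
Proof. by move=> nX; apply: evG0 => -[]. Qed.
Lemma evSv v f U g : X U -> U (kid L v) -> ev (repS (kid L v)) f (U, g) = f (U, g).
Proof. by move=> hX hv; rewrite evS// strip_id ?c0 ?subr0//; exact: XB. Qed.

Lemma prep_id v U : bdfilter U -> U (kid L v) -> prep (kid L v) U = U.
Proof. by move=> hU hv; rewrite -[in LHS](strip_id hU hv) prep_strip. Qed.

Lemma evSG l f U g : X U -> U l -> ev (repS l ** repG l) f (U, g) = f (U, g).
Proof.
move=> hX hl; rewrite evM evS// evG; [|exact: Xstrip|exact: strip_in].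
by rewrite prep_strip ?subrK//; exact: XB.
Qed.

Lemma rep_family : is_KP_family repS repG.
Proof.
split.
- move=> v; apply: ev_ext => f U g hX; [|exact: evG_out|exact: evS_out].
  have [hv|hv] := pselect (U (kid L v)).
    by rewrite evSv// evG ?ksrc_id// prep_id ?c0 ?addr0//; exact: XB.
  by rewrite evS0 ?evG0 ?ksrc_id//; case.
- move=> v w; case: eqP => [<-|ne]; apply: ev_ext => f U g hX; rewrite ?evM//;
    try exact: evS_out.
    have [hv|hv] := pselect (U (kid L v)); first by rewrite !evSv.
    by rewrite !evS0//; case.
  have [hv|hv] := pselect (U (kid L v)); last by rewrite evS0//; case.
  rewrite evSv// evS0// => -[_ hw]; apply: ne.
  by have := bf_rng (XB hX) hv hw; rewrite !krng_id.
- move=> mu nu e; split; apply: ev_ext => f U g hX; rewrite ?evM;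
    try exact: evS_out; try exact: evG_out.
    have [hmn|hmn] := pselect (U (kcomp mu nu)).
      have hm : U mu by apply: (bf_her (XB hX)) hmn; exact: pre_comp.
      rewrite !evS//; last exact: Xstrip.
      by rewrite strip_comp// cD// opprD addrA.
    rewrite [RHS]evS0; last by case.
    have [hm|hm] := pselect (U mu); last by rewrite evS0//; case.
    by rewrite evS// evS0// => -[_ []].
  have [hn|hn] := pselect (U (kid L (ksrc nu))); last first.
    by rewrite !evG0// ?ksrc_comp//; case.
  have hX2 : X (prep nu U) by exact: Xprep.
  have h2 : prep nu U (kid L (ksrc mu)).
    by rewrite e; apply: (bf_id (XB hX2)); exact: prep_in.
  rewrite !evG// ?ksrc_comp// prep_comp//; last exact: XB.
  by rewrite cD// -addrA [c nu + _]addrC.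
(* (KP3): if the filter [prep mu U] contains [nu], directedness gives exactly one minimal pair [p]
   with [p.1] in [U], and only its summand is nonzero at [U]; otherwise both sides vanish. *)
- move=> mu nu; have fin : finite_set (Lmin mu nu) := fa mu nu.
  rewrite fsbig_finite//; apply: ev_ext => f U g hX; rewrite ?ev_sum ?evM.
  + rewrite (eq_big_seq (fun p => ev (repS p.1) (ev (repG p.2) f) (U, g)))//.
    have [hm|hm] := pselect (U (kid L (ksrc mu))); last first.
      rewrite evG0; last by case.
      rewrite big_seq big1// => p; rewrite in_fset_set// => /set_mem[h1 _ _ _].
      rewrite evS0// => -[_ /(bf_id (XB hX))]; by rewrite -h1.
    have hX2 : X (prep mu U) by exact: Xprep.
    have hB := XB hX2.
    have rU a : U a -> ksrc mu = krng a.
      by move=> ha; have := bf_rng (XB hX) ha hm; rewrite krng_id.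
    have pU a : U a -> prep mu U (kcomp mu a).
      by move=> ha; apply/prepE => //; [exact: XB|exact: rU].
    rewrite evG//; have [hn|hn] := pselect (prep mu U nu); last first.
      rewrite evS0; last by case.
      rewrite big_seq big1// => p; rewrite in_fset_set// => /set_mem[h1 h2 e _].
      rewrite evS0// => -[_ /pU ha]; apply: hn.
      by apply: (bf_her hB) ha; rewrite e; exact: pre_comp.
    have [z hz [p1 p2]] := bf_dir hB (prep_in hm) hn.
    have [y /MCE_Lmin[p hp [ey ey2]] py] := MCE_of_ext p1 p2.
    have hy : prep mu U y := bf_her hB py hz.
    case: (hp) => h1 h2 e _.
    have hpU : U p.1 by move: hy; rewrite ey => /prepE; apply=> //; exact: XB.
    rewrite (bigD1_seq p) ?fset_uniq//; last by rewrite in_fset_set//; exact: mem_set.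
    rewrite [X in _ = _ + X]big_seq_cond [X in _ = _ + X]big1; last first.
      move=> p' /andP[]; rewrite in_fset_set// => /set_mem hp' /eqP ne.
      rewrite evS0// => -[_ /pU ha]; apply: ne.
      have [z' hz' [q1 q2]] := bf_dir hB ha hy.
      by apply: (Lmin_uniq hp' hp q1); rewrite -ey.
    have hX3 : X (strip p.1 U) by exact: Xstrip.
    have hs : strip p.1 U (kid L (ksrc p.2)).
      have <- : ksrc p.1 = ksrc p.2.
        by have := congr1 (@ksrc _ L) e; rewrite !ksrc_comp.
      exact: strip_in.
    rewrite [RHS]addr0 (evS _ _ hX2 hn) (evS _ _ hX hpU) (evG _ _ hX3 hs).
    congr (f (_, _)).
      have hs2 : strip nu (prep mu U) p.2.
        by split=> //; rewrite -e; exact: pU.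
      rewrite -[LHS](prep_strip (bf_strip hB hn) hs2) -strip_comp// -e strip_comp//.
      by rewrite strip_prep//; exact: XB.
    have := congr1 c e; rewrite !cD// => ec.
    rewrite -[RHS](addrK (c nu)); congr (_ - _); rewrite -!addrA; congr (_ + _).
    by rewrite [c p.2 + _]addrC -ec [c mu + _]addrC addKr.
  + exact: evG_out.
  + by rewrite big1// => p _; rewrite evM; exact: evS_out.
(* (KP4): a filter through [v] meets [F], so one of the factors is 0 there. *)
- move=> v F hF.
  have hr mu : mu \in F -> krng mu = v by case: hF => -[hF _] _ /hF.
  have step mu y f U g : X U -> krng mu = v ->
      ev ((repS (kid L v) - repS mu ** repG mu) ** y) f (U, g)
      = if `[<U (kid L v) /\ ~ U mu>] then ev y f (U, g) else 0.
    move=> hX hm; rewrite evM evB; case: asboolP => [[hv nm]|hv].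
      by rewrite evSv// evM (evS0 (l := mu)) ?subr0//; case.
    have [hv'|nv] := pselect (U (kid L v)); last first.
      rewrite evS0; last by case.
      rewrite evM evS0 ?subr0// => -[_ /(bf_id (XB hX))].
      by rewrite hm.
    have hm' : U mu by apply: contrapT => nm; apply: hv.
    by rewrite evSv// evSG ?subrr.
  have out f U g : ~ X U -> ev (\big[@numul R E/repS (kid L v)]_(mu <- F)
      (repS (kid L v) - repS mu ** repG mu)) f (U, g) = 0.
    move=> nX; case: (F : seq _) => [|mu s]; first by rewrite big_nil evS_out.
    by rewrite big_cons evM evB evS_out// evM evS_out// subrr.
  apply: ev_ext => // f U g hX; rewrite [RHS]ev0.
  have {hr} : all (fun mu => krng mu == v) F by apply/allP => mu /hr ->.
  have : U (kid L v) -> has (fun mu => `[<U mu>]) F.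
    move=> hv; have [|mu hmu] := bf_bd (XB hX) hv (E := F); first by rewrite ksrc_id.
    have hm : krng mu = v by case: hF => -[h _] _; exact: h.
    by rewrite -{1}hm kcomp_idl => um; apply/hasP; exists mu => //; apply/asboolP.
  elim: (F : seq _) => [|mu s IH] /= hU.
    by rewrite big_nil evS0// => -[_ /hU].
  move=> /andP[/eqP hm hs]; rewrite big_cons step//; case: asboolP => // -[hv nm].
  by apply: IH => // /hU; rewrite asboolF.
Qed.

End Representation.

(** * Simplicity forces a field, cofinality and aperiodicity *)

Section Necessity.
Variables (R : comPzRingType) (k : nat) (L : kgraph k).
Hypothesis fa : finitely_aligned L.
Implicit Types (v w : kvert L) (l mu nu a b : kpath L).

Notation A := (KP R L).

Lemma ker_ideal (B : nualg R) (f : A -> B) : is_nuhom f ->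
  two_sided_ideal [set x : A | f x = 0].
Proof.
move=> [fD fZ fM].
have f0 : f 0 = 0 by rewrite -(scale0r (0 : A)) fZ scale0r.
have fB x y : f (x - y) = f x - f y by rewrite fD -scaleN1r fZ scaleN1r.
split=> [|x a /= ex]; last by rewrite fM ex numul0r.
split=> [|x a /= ex]; last by rewrite fM ex numul0l.
by split=> // x y /= ex ey; rewrite fB ex ey subrr.
Qed.

Lemma simple_faithful (B : nualg R) (S G : kpath L -> B) : is_KP_family S G ->
  nusimple A -> (exists l, S l <> 0) -> forall x : A, kpval S G x = 0 -> x = 0.
Proof.
move=> hB [_ hs] [l hl] x ex.
case: (hs _ (ker_ideal (kpval_hom hB))) => e.
  have : [set y : A | kpval S G y = 0] x by [].
  by rewrite e.
have : [set y : A | kpval S G y = 0] (kps R l) by rewrite e.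
by move=> /=; rewrite kpval_s.
Qed.

Lemma zdeg_id v : zdeg (kid L v) = 0.
Proof. by apply/ffunP => i; rewrite !ffunE kdeg_id ffunE. Qed.
Lemma zdeg_comp l mu : ksrc l = krng mu -> zdeg (kcomp l mu) = zdeg l + zdeg mu.
Proof. by move=> e; apply/ffunP => i; rewrite !ffunE kdeg_comp// degE PoszD. Qed.

Definition allbf : set (set (kpath L)) := @bdfilter k L.

Lemma allbf_strip U l : allbf U -> U l -> allbf (strip l U).
Proof. exact: bf_strip. Qed.
Lemma allbf_prep U l : allbf U -> U (kid L (ksrc l)) -> allbf (prep l U).
Proof. exact: bf_prep. Qed.

Definition graded_rep := @rep_family R k L fa allbf (@zdeg k L)
  (fun U h => h) allbf_strip allbf_prep zdeg_id zdeg_comp.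

Definition zero_cocycle l : grade k := 0.
Lemma zero_cocycleD l mu : ksrc l = krng mu ->
  zero_cocycle (kcomp l mu) = zero_cocycle l + zero_cocycle mu.
Proof. by rewrite /zero_cocycle addr0. Qed.

Definition ungraded_rep := fun X XB Xs Xp => @rep_family R k L fa X zero_cocycle
  XB Xs Xp (fun=> erefl) zero_cocycleD.

(** In the graded representation, the image of the constant function 1 takes the value [r] at a
    filter through [l]. *)
Lemma kps_neq0 (r : R) l : r <> 0 -> r *: (kps R l : A) <> 0.
Proof.
move=> nr e; have [U hU Ul] := bf_exists fa (ksrc l).
have := congr1 (fun x =>
  ev (kpval (repS R allbf (@zdeg k L)) (repG R allbf (@zdeg k L)) x)
  (fun=> 1) (prep l U, 0)) e.
have [_ fZ _] := kpval_hom graded_rep.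
rewrite fZ kpval_s; last exact: graded_rep.
rewrite [ev (r *: _) _ _]
  (_ : _ = r *: ev (repS R allbf (@zdeg k L) l) (fun=> 1) (prep l U, 0))//.
rewrite evS; [|exact: bf_prep|exact: prep_in].
rewrite (kpval_zero graded_rep) ev0 => e1.
by apply: nr; rewrite -[LHS]mulr1; exact: e1.
Qed.

Lemma simple_one_neq0 : nusimple A -> (1 : R) <> 0.
Proof.
move=> [[x nx] _] e; apply: nx.
by rewrite -[x]scale1r e scale0r.
Qed.

Lemma simple_vertex : nusimple A -> exists v : kvert L, True.
Proof.
move=> [[x nx] _]; have [[|[r [a b]] s] es] := kp_terms fa x.
  by rewrite es big_nil in nx.
by exists (krng a).
Qed.

Lemma kps_neq01 l : nusimple A -> (kps R l : A) <> 0.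
Proof. by move=> /simple_one_neq0/kps_neq0 => /(_ l); rewrite scale1r. Qed.

(** The nonzero ideal [r] KP contains s_v = [r x]; evaluating both sides on the constant function 1
    at a filter through [v] exhibits an inverse of [r]. *)
Lemma simple_field : nusimple A -> is_field R.
Proof.
move=> hs; have n1 := simple_one_neq0 hs; split=> // r nr.
have [v _] := simple_vertex hs; have [U hU Uv] := bf_exists fa v.
pose I := [set r *: x | x in [set: A]].
have hI : two_sided_ideal I.
  split; first split; first split.
  - by exists 0 => //; rewrite scaler0.
  - by move=> _ _ [x _ <-] [y _ <-]; exists (x - y) => //; rewrite scalerBr.
  - by move=> _ y [x _ <-]; exists (x ** y) => //; rewrite numulZl.
  - by move=> _ y [x _ <-]; exists (y ** x) => //; rewrite numulZr.
case: hs => _ /(_ I hI)[e|e].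
  have : I (r *: kps R (kid L v)) by exists (kps R (kid L v)).
  by rewrite e => /kps_neq0.
have [x _ ex] : I (kps R (kid L v)) by rewrite e.
pose f (x : A) := ev (kpval (repS R allbf (@zdeg k L)) (repG R allbf (@zdeg k L)) x)
  (fun=> 1) (U, 0).
exists (f x).
have <- : f (kps R (kid L v)) = 1.
  by rewrite /f (kpval_s graded_rep) evS.
rewrite -ex /f; have [_ fZ _] := kpval_hom graded_rep.
by rewrite fZ.
Qed.

Lemma simple_cofinal : nusimple A -> cofinal L.
Proof.
move=> hs; apply/cofinalP => v U0 hU0; apply: contrapT => hno.
(* The filters having a shift in common with [U0]. None of them passes through [v], since [v] would
   then lie below the source of a member of [U0]; so s_v acts as 0. *)
pose X : set (set (kpath L)) := [set U | bdfilter U /\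
  exists a b, [/\ U0 a, U b & strip a U0 = strip b U]].
have XB U : X U -> bdfilter U by case.
have Xs U l : X U -> U l -> X (strip l U).
  move=> [hU [a [b [ha hb e]]]] hl; split; first exact: bf_strip.
  have [c hc [[b' hb' eb] [l' hl' el]]] := bf_dir hU hb hl.
  have sb : strip b U b' by split=> //; rewrite -eb.
  have [ha' uab] : strip a U0 b' by rewrite e.
  exists (kcomp a b'), l'; split=> //; first by split=> //; rewrite -el.
  by rewrite strip_comp// e -!strip_comp// -eb -el.
have Xp U l : X U -> U (kid L (ksrc l)) -> X (prep l U).
  move=> [hU [a [b [ha hb e]]]] hl; split; first exact: bf_prep.
  have hlb : ksrc l = krng b by have := bf_rng hU hb hl; rewrite krng_id.
  exists a, (kcomp l b); split=> //; first by apply/prepE.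
  by rewrite strip_comp// strip_prep.
have hrep := ungraded_rep XB Xs Xp.
apply: (kps_neq01 (l := kid L v) hs).
apply: (simple_faithful hrep hs).
  have [a ha] : exists a, U0 a by case: hU0.
  have hid := bf_id hU0 ha.
  exists (kid L (krng a)) => /(congr1 (fun x => ev x (fun=> 1) (U0, 0))).
  rewrite ev0 evS//; last by split=> //; exists a, a.
  exact: simple_one_neq0.
rewrite (kpval_s hrep); apply: ev_ext => // f U g; last exact: evS_out.
move=> hX; rewrite [RHS]ev0; apply: evS0 => -[_ hv].
case: hX => hU [a [b [ha hb e]]]; apply: hno; exists a => //.
have : strip b U (kid L (ksrc a)) by rewrite -e; exact: strip_in.
move=> [eab _]; rewrite krng_id in eab; exists b; split=> //.
by have := bf_rng hU hb hv; rewrite krng_id.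
Qed.

Lemma simple_aperiodic : nusimple A -> aperiodic L.
Proof.
move=> hs; apply/aperiodicP => v m n mn; apply: contrapT => hno.
have {hno} per U : bdfilter U -> U (kid L v) -> exists a b c,
    [/\ U a, U b & U c] /\ [/\ kdeg a = m, kdeg b = n, kdeg c = dmax m n
      & strip a U = strip b U].
  move=> hU hv; apply: contrapT => h; apply: hno; exists U; split=> // a b c.
  by move=> ha hb hc da db dc e; apply: h; exists a, b, c.
have [U hU hv] := bf_exists fa v.
have [a [b [c [[ha hb hc] [da db dc est]]]]] := per U hU hv.
have pac : pre a c.
  by apply: (bf_chain hU ha hc); rewrite da dc; exact: dle_maxl.
have pbc : pre b c.
  by apply: (bf_chain hU hb hc); rewrite db dc; exact: dle_maxr.
have [al hal ec] := pac.
have sab : ksrc b = ksrc a.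
  have : strip b U (kid L (ksrc a)) by rewrite -est; exact: strip_in.
  by move=> []; rewrite krng_id.
have hbl : ksrc b = krng al by rewrite sab.
have ra : krng a = v by rewrite (bf_rng hU ha hv) krng_id.
have rb : krng b = v by rewrite (bf_rng hU hb hv) krng_id.
pose d := kcomp b al.
have sd : ksrc d = ksrc c by rewrite /d ec !ksrc_comp.
have sc : ksrc c = ksrc al by rewrite ec ksrc_comp.
(* The filter [c y] starts at [v] and has prefixes [a] and [b], so its periodicity gives that
   removing [b] leaves [al y], that is, [c y] = [b al y] = [d y]. *)
have prepcd y : bdfilter y -> y (kid L (ksrc al)) -> prep c y = prep d y.
  move=> hy yal; have yc : y (kid L (ksrc c)) by rewrite sc.
  pose W := prep c y; have hW : bdfilter W by exact: bf_prep.
  have Wc : W c by exact: prep_in.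
  have Wv : W (kid L v) by have := bf_id hW Wc; rewrite -(pre_rng pac) ra.
  have [a' [b' [c' [[ha' hb' hc'] [da' db' dc' est']]]]] := per W hW Wv.
  have ea : a' = a.
    by apply: (bf_same hW) => //; [apply: (bf_her hW) Wc|rewrite da da'].
  have eb : b' = b.
    by apply: (bf_same hW) => //; [apply: (bf_her hW) Wc|rewrite db db'].
  subst a' b'.
  have hyal : bdfilter (prep al y) by exact: bf_prep.
  have yr x : ksrc x = krng al -> prep al y (kid L (ksrc x)).
    by move=> ->; apply: (bf_id hyal); exact: prep_in.
  have eW : W = prep a (prep al y) by rewrite /W ec prep_comp.
  have e1 : prep al y = strip a W by rewrite eW strip_prep//; exact: yr.
  by rewrite /d prep_comp// e1 est' prep_strip.
pose x : A := kps R c - kps R d.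
(* The indicator of the grade - d(c) detects [c] and not [d], because d(c) and d(d) differ as [m]
   and [n] do. *)
have nx : x <> 0.
  move=> /(congr1 (fun x => ev (kpval (repS R allbf (@zdeg k L))
    (repG R allbf (@zdeg k L)) x) (fun p => if p.2 == - zdeg c then 1 else 0)
    (U, 0))).
  rewrite (kpval_zero graded_rep) (kpval_sub graded_rep) !(kpval_s graded_rep).
  rewrite ev0 evB evS// add0r eqxx.
  have Ud : U d.
    have : strip a U al by split=> //; rewrite -ec.
    by rewrite est => -[].
  rewrite evS// add0r; case: eqP => [/oppr_inj e _|_]; last first.
    by rewrite subr0; exact: simple_one_neq0.
  apply: mn; apply: (@deg_addIl _ (kdeg al)).
  rewrite -{1}da -db -!kdeg_comp// -ec -/d; apply: degP => i.
  by have /ffunP/(_ i) := e; rewrite !ffunE => -[].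
have hrep := ungraded_rep (X := allbf) (fun U h => h) allbf_strip allbf_prep.
apply: nx; apply: (simple_faithful hrep hs).
  exists (kid L v) => /(congr1 (fun x => ev x (fun=> 1) (U, 0))).
  by rewrite ev0 evS//; exact: simple_one_neq0.
rewrite (kpval_sub hrep) !(kpval_s hrep); apply: ev_ext => // f W g hW.
  rewrite evB [RHS]ev0.
  (* By [prepcd], filters through [c] are those through [d], with the same remainder. *)
  have key y z : ksrc y = ksrc c -> ksrc z = ksrc c ->
      (forall u, bdfilter u -> u (kid L (ksrc al)) -> prep y u = prep z u) ->
      W y -> W z /\ strip z W = strip y W.
    move=> ey ez hyz Wy; have h1 := bf_strip hW Wy.
    have h2 : strip y W (kid L (ksrc al)) by rewrite -sc -ey; exact: strip_in.
    have eW : W = prep z (strip y W) by rewrite -hyz// prep_strip.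
    have h3 : strip y W (kid L (ksrc z)) by rewrite ez sc.
    by split; [rewrite eW; exact: prep_in|rewrite {1}eW strip_prep].
  have [Wc|nc] := pselect (W c).
    have [Wd ed] := key c d erefl sd prepcd Wc.
    by rewrite !evS// ed /zero_cocycle subrr.
  rewrite !evS0 ?subr0//; last by case.
  move=> [_ Wd]; apply: nc.
  by have [] := key d c sd erefl (fun u h1 h2 => esym (prepcd u h1 h2)) Wd.
by rewrite evB !evS_out// subr0.
Qed.

End Necessity.

(** * Infinite idempotents and cycles *)

Section Idempotents.
Variables (R : comPzRingType) (A : nualg R).
Implicit Types (e p q x y z : A).

Lemma rprincipal_ideal x : right_ideal (rprincipal x).
Proof.
split; first split.
- by exists 0 => //; rewrite numul0r.
- by move=> _ _ [y _ <-] [z _ <-]; exists (y - z) => //; rewrite numulBr.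
- by move=> _ a [y _ <-]; exists (y ** a) => //; rewrite numulA.
Qed.

(** Left multiplication by [p] is an isomorphism from [e A] to [p A], inverted by [q]; the
    complement of [p A] in [e A] is cut out by [e - p q]. *)
Lemma infinite_idempotentP e p q : e ** e = e -> e ** p = p -> p ** e = p ->
  e ** q = q -> q ** e = q -> q ** p = e -> p ** q <> e -> infinite_idempotent e.
Proof.
move=> ee ep pe eq qe qp npq; split=> //.
have q0 : q ** (e - p ** q) = 0 by rewrite numulBr qe numulA qp eq subrr.
have ppq : e ** (e - p ** q) = e - p ** q by rewrite numulBr ee numulA ep.
exists (rprincipal p); split.
  split; first exact: rprincipal_ideal.
  split.
    move=> E; have [z _ ez] : rprincipal p e by rewrite E; exists e.
    by apply: npq; rewrite -qe -ez !numulA -(numulA p) qp pe.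
  exists (rprincipal (e - p ** q)); split; first exact: rprincipal_ideal.
    apply/seteqP; split=> [_ [[z _ <-] [y _ ey]]|_ ->]; last first.
      by split; exists 0 => //; rewrite numul0r.
    have : q ** (p ** z) = 0 by rewrite -ey numulA q0 numul0l.
    by rewrite /= numulA qp => ez; rewrite -pe -numulA ez numul0r.
  apply/seteqP; split=> [_ [z _ <-]|_ [_ [y _ <-] [_ [z _ <-] <-]]].
    exists (p ** (q ** z)); first by exists (q ** z).
    exists ((e - p ** q) ** z); first by exists z.
    by rewrite numulA -numulDl addrC subrK.
  exists (p ** y + (e - p ** q) ** z) => //.
  by rewrite numulDr !numulA ep ppq.
exists (fun x => p ** x); split.
- split.
  + by move=> _ [z _ <-]; exists (e ** z).
  + move=> _ _ /set_mem[y _ <-] /set_mem[z _ <-] /(congr1 (fun x => q ** x)).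
    by rewrite !numulA qp ee.
  + move=> _ [z _ <-]; exists (e ** z); first by exists z.
    by rewrite numulA pe.
- by move=> x y _ _; rewrite numulDr.
- by move=> x a _; rewrite numulA.
Qed.

Lemma two_sidedL (I : set A) x a : two_sided_ideal I -> I x -> I (a ** x).
Proof. by case=> _; exact. Qed.
Lemma two_sidedR (I : set A) x a : two_sided_ideal I -> I x -> I (x ** a).
Proof. by case=> -[_ +] _; exact. Qed.
Lemma two_sided_subgroup (I : set A) : two_sided_ideal I -> addsubgroup I.
Proof. by case=> -[]. Qed.

End Idempotents.

(** * The reachability preorder and terminal vertices *)

Section Graph.
Variables (k : nat) (L : kgraph k).
Implicit Types (v w u t : kvert L) (l mu nu a b c : kpath L).

Lemma vle_trans u v w : vle u v -> vle v w -> vle u w.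
Proof.
move=> [a [<- ea]] [b [eb <-]]; exists (kcomp a b).
by rewrite krng_comp ?ksrc_comp// ea.
Qed.
Lemma vle_refl v : vle v v.
Proof. by exists (kid L v); rewrite krng_id ksrc_id. Qed.

(** Induction on the number of vertices above [w]: if [z] is above [w] but not conversely, the set
    above [z] loses [w]. *)
Lemma maximal_above w : (forall v : kvert L, finite_set [set z | vle v z]) ->
  exists2 u, vle w u & forall z, vle u z -> vle z u.
Proof.
move=> fin; pose up v := fset_set [set z | vle v z].
have upP v z : z \in up v <-> vle v z.
  by rewrite in_fset_set//; split=> [/set_mem|/mem_set].
move: {2}#|` up w|.+1 (ltnSn #|` up w|) => n; elim: n w => // n IH w le.
have [h|h] := pselect (forall z, vle w z -> vle z w).
  by exists w => //; exact: vle_refl.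
have [z hz nz] : exists2 z, vle w z & ~ vle z w.
  by apply: contrapT => h'; apply: h => z hz; apply: contrapT => nz; apply: h'; exists z.
have lt : (#|` up z| < #|` up w|)%N.
  apply: fproper_ltn_card; rewrite fproperE; apply/andP; split.
    by apply/fsubsetP => x /upP hx; apply/upP; exact: vle_trans hx.
  by apply/negP => /fsubsetP sub; apply: nz; apply/upP/sub/upP; exact: vle_refl.
have [|u hu mu] := IH z; first exact: leq_trans lt _.
by exists u => //; exact: vle_trans hu.
Qed.

Definition terminal t := forall l, krng l = t -> l = kid L t.

Lemma terminal_pre t l c : terminal t -> ksrc l = t -> pre l c -> c = l.
Proof.
move=> ht el [a ha ->].
by rewrite (ht a) -?ha// -el kcomp_idr.
Qed.

(** This is the boundary path of degree 0: an exhaustive set at [t] contains the vertex path, so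
    [FE t] is empty. *)
Lemma terminal_bf t : terminal t -> bdfilter [set kid L t].
Proof.
move=> ht; split.
- by exists (kid L t).
- by move=> a b pab /= eb; apply: ht; rewrite (pre_rng pab) eb krng_id.
- by move=> a b /= -> ->; exists (kid L t) => //; split; exact: pre_refl.
- move=> l E /= ->; rewrite ksrc_id => -[[h1 h2] h3]; exfalso.
  have [mu [hmu _]] := h2 (kid L t) (krng_id t).
  by move: h3; rewrite -(ht mu (h1 _ hmu)) hmu.
Qed.

End Graph.

(** * Cofinality, aperiodicity and a cycle over a field suffice *)

Section Sufficiency.
Variables (R : comPzRingType) (k : nat) (L : kgraph k).
Hypothesis fa : finitely_aligned L.
Variables (A : nualg R) (S G : kpath L -> A).
Hypothesis h : is_KP_family S G.
Hypothesis terms : forall x : A, exists s : seq (R * (kpath L * kpath L)),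
  x = \sum_(t <- s) t.1 *: (S t.2.1 ** G t.2.2).
Hypothesis Sneq0 : forall l, S l <> 0.
Implicit Types (v w u t : kvert L) (l mu nu a b c : kpath L) (x y z : A).

Notation Sv v := (S (kid L v)).

Lemma vertices_full (I : set A) : two_sided_ideal I -> (forall v, I (Sv v)) -> I = setT.
Proof.
move=> hI hv; have [I0 IB] := two_sided_subgroup hI.
apply/seteqP; split=> x // _; have [s ->] := terms x.
apply: (big_ind I) => //; first exact: (subgroupD I0 IB).
move=> t _; have -> : t.1 *: (S t.2.1 ** G t.2.2) =
    Sv (krng t.2.1) ** (t.1 *: (S t.2.1 ** G t.2.2)).
  by rewrite numulZr numulA (KP_rS h).
exact: two_sidedR.
Qed.

(** If s_v is outside [I], the ultrafilter for [J] = [I] has no member [l] with s_v s_l s_l^* in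
    [I]. Cofinality gives [l] in it and [m] from [w] to the source of [l], and s_m^* s_w s_m puts
    that source idempotent into [I]. *)
Lemma cofinal_full (I : set A) w : cofinal L -> two_sided_ideal I -> I (Sv w) -> I = setT.
Proof.
move=> /cofinalP cof hI hw; apply: vertices_full => // v; apply: contrapT => nv.
have [I0 IB] := two_sided_subgroup hI.
have Iq a x : I x -> I (rcut S G a x) by exact: two_sidedR.
have [U [hU _ hd]] := KP_ultrafilter fa h I0 IB Iq (KP_vv h v) nv.
have [l hl [m [rm sm]]] := cof w U hU.
apply: (hd l [::] hl) => //=.
suff : I (S l ** G l) by move=> ?; exact: two_sidedL.
rewrite -(KP_Ss h l) -sm -(KP_GS h m) -(KP_rS h m) rm.
by apply: two_sidedR => //; do 2! apply: two_sidedL => //; exact: two_sidedR.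
Qed.

Lemma sufficient_simple (v : kvert L) :
  is_field R -> cofinal L -> aperiodic L -> nusimple A.
Proof.
move=> hR cof ap; split; first by exists (Sv v).
move=> I hI; have [I0 _] := two_sided_subgroup hI.
have [[x Ix nx]|hno] := pselect (exists2 x, I x & x <> 0); last first.
  left; apply/seteqP; split=> [x Ix|_ -> //].
  by apply: contrapT => nx; apply: hno; exists x.
right; have [y [z [w e]]] := compress fa h terms hR ap nx.
apply: (cofinal_full cof hI (w := w)); rewrite -e.
by apply: two_sidedR => //; exact: two_sidedL.
Qed.

(* The paths [mu^n l0] from the range of the cycle to [t] are infinitely many
   minimal projections below a vertex; an ultrafilter avoiding finite sets of
   them is a boundary path that never reaches [t]. *)
Lemma no_terminal t mu : cofinal L -> kdeg mu <> 0 -> ksrc mu = krng mu -> ~ terminal t.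
Proof.
move=> /cofinalP cof /deg_neqP[i hi] emu ht.
pose u := krng mu.
have [_ -> [l0 [rl0 sl0]]] := cof u _ (terminal_bf ht); rewrite ksrc_id in sl0.
(* The elements killing all but finitely many of the paths ending at [t]. *)
pose J : set A := [set x | exists F : seq (kpath L),
  forall l, ksrc l = t -> l \notin F -> x ** S l = 0].
have J0 : J 0 by exists [::] => l _ _; rewrite numul0l.
have JB x y : J x -> J y -> J (x - y).
  move=> [F hF] [F' hF']; exists (F ++ F') => l sl.
  rewrite mem_cat negb_or => /andP[n1 n2].
  by rewrite numulBl hF// hF'// subrr.
have GS0 nu l : ksrc l = t -> ~ pre nu l -> G nu ** S l = 0.
  move=> sl np; apply: (KP_GS0 h) => -[c p1 p2]; apply: np.
  by rewrite (terminal_pre ht sl p2) in p1.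
have Jq nu x : J x -> J (rcut S G nu x).
  move=> [F hF]; exists F => l sl nl; rewrite /rcut -!numulA.
  have [[c hc e]|np] := pselect (pre nu l); last by rewrite GS0// !numul0r.
  by rewrite {1}e (KP_GSpre h hc) (KP_comp h hc) -e; exact: hF.
have nJ : ~ J (Sv u).
  move=> [F hF].
  pose g n := iter n (kcomp mu) l0.
  have gP n : [/\ krng (g n) = u, ksrc (g n) = t & (n <= kdeg (g n) i)%N].
    elim: n => [|n [r s d]]; first by rewrite /g /=.
    have e : ksrc mu = krng (g n) by rewrite r emu.
    rewrite /g iterS -/(g n); split; rewrite ?krng_comp ?ksrc_comp//.
    by rewrite kdeg_comp// degE; lia.
  pose n := (\max_(l <- F) kdeg l i).+1.
  have [r s d] := gP n.
  apply: (@Sneq0 (g n)); rewrite -(KP_rS h) r; apply: hF => //.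
  apply/negP => hg; move: d; rewrite leqNgt /n ltnS.
  by rewrite (@leq_bigmax_seq _ _ xpredT (fun l => kdeg l i) _ hg).
have [U [hU Uu hd]] := KP_ultrafilter fa h J0 JB Jq (KP_vv h u) nJ.
have [l hl [m [rm sm]]] := cof t U hU.
have sl : ksrc l = t by rewrite -sm (ht m rm) ksrc_id.
(* As [t] is terminal, [l] is the only path ending at [t] that extends [l], so the cut at [l] lies
   in [J]. *)
apply: (hd l [::] hl) => //=; exists [:: l] => l' sl'; rewrite inE => /eqP ne.
rewrite /rcut -!numulA GS0 ?numul0r// => p; apply: ne.
exact: terminal_pre sl p.
Qed.

(** Above a maximal [u] every path can be continued back to [u]. By [no_terminal] this yields a
    closed path [c0] of nonzero degree; aperiodicity for [c0] and the vertex path gives [b]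
    incompatible with [c0 b], and [c] closes up [c0 b]. *)
Lemma strict_cycle w : cofinal L -> aperiodic L -> has_cycle L ->
  (forall v : kvert L, finite_set [set z | vle v z]) ->
  exists u c b, [/\ vle w u, krng c = u, ksrc c = u, krng b = u & ~ compat c b].
Proof.
move=> cof ap [mu [dmu emu]] fin; have [u wu hu] := maximal_above w fin.
have [l0 rl0 dl0] : exists2 l, krng l = u & kdeg l <> 0.
  apply: contrapT => hno; apply: (no_terminal (t := u) cof dmu emu) => l rl.
  rewrite -rl; apply: deg0_id; apply: contrapT => dl; by apply: hno; exists l.
have [m [rm sm]] : vle (ksrc l0) u by apply: hu; exists l0.
pose c0 := kcomp l0 m.
have rc0 : krng c0 = u by rewrite krng_comp.
have sc0 : ksrc c0 = u by rewrite ksrc_comp.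
have dc0 : kdeg c0 <> kdeg (kid L u).
  rewrite kdeg_id kdeg_comp// => /ffunP e; apply: dl0; apply: degP => i.
  by have := e i; rewrite !degE; lia.
have [|b] := aperiodic_separates fa ap _ dc0; first by rewrite ksrc_id.
rewrite sc0 => rb; rewrite {1}rb kcomp_idl => nc.
have [n [rn sn]] : vle (ksrc b) u by apply: hu; exists b.
have hb : ksrc c0 = krng b by rewrite sc0.
have hn : ksrc (kcomp c0 b) = krng n by rewrite ksrc_comp.
exists u, (kcomp (kcomp c0 b) n), b; split=> //.
- by rewrite !krng_comp.
- by rewrite ksrc_comp.
- by move=> hc; apply: nc; apply: compat_prel hc; exact: pre_comp.
Qed.

(** Since [Y a Z] = s_u, the map s to [a Z s Y] is multiplicative on the corner at [u] and has
    values in [I]; it carries s_u, s_c and s_c^* to the elements required by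
    [infinite_idempotentP]. *)
Lemma sufficient_infinite : is_field R -> cofinal L -> aperiodic L -> has_cycle L ->
  (forall v : kvert L, finite_set [set z | vle v z]) -> purely_infinite A.
Proof.
move=> hR cof ap cyc fin I hI nI.
have [a Ia na] : exists2 a, I a & a <> 0.
  apply: contrapT => hno; apply: nI; apply/seteqP; split=> [x Ix|_ ->].
    by apply: contrapT => nx; apply: hno; exists x.
  by case: hI => -[].
have [y [z [w e]]] := compress fa h terms hR ap na.
have [u [c [b [[l [rl sl]] rc sc rb ncb]]]] := strict_cycle w cof ap cyc fin.
pose Y := G l ** y; pose Z := z ** S l.
have YaZ : Y ** (a ** Z) = Sv u.
  have -> : Y ** (a ** Z) = G l ** (y ** a ** z) ** S l by rewrite /Y /Z !numulA.
  by rewrite e -numulA -rl (KP_rS h) (KP_GS h) sl.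
have uY : Sv u ** Y = Y by rewrite /Y numulA -sl (KP_sG h).
have Zu : a ** Z ** Sv u = a ** Z by rewrite /Z -!numulA -sl (KP_Ss h).
have mid s s' : a ** Z ** s ** Y ** (a ** Z ** s' ** Y) =
    a ** Z ** (s ** Sv u ** s') ** Y.
  rewrite -YaZ; move: (a ** Z) => q; by rewrite !numulA.
have Su : Sv u ** Sv u = Sv u := KP_vv h u.
have uS : Sv u ** S c = S c by rewrite -rc (KP_rS h).
have Scu : S c ** Sv u = S c by rewrite -sc (KP_Ss h).
have uG : Sv u ** G c = G c by rewrite -sc (KP_sG h).
have Gu : G c ** Sv u = G c by rewrite -rc (KP_Gr h).
have GS : G c ** S c = Sv u by rewrite (KP_GS h) sc.
exists (a ** Z ** Sv u ** Y); split.
  by case: hI => _ hr; rewrite -!numulA; exact: hr.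
apply: (infinite_idempotentP (p := a ** Z ** S c ** Y) (q := a ** Z ** G c ** Y));
  rewrite ?mid ?Su ?uS ?Scu ?uG ?Gu ?GS ?Su//.
move=> /(congr1 (fun x => Y ** x ** (a ** Z))).
(* Multiplying back by [Y] and [a Z] recovers s_c s_c^* = s_u, which is refuted by s_b: it is killed
   by s_c^* but fixed by s_u. *)
have out s : Y ** (a ** Z ** s ** Y) ** (a ** Z) = Sv u ** s ** Sv u.
  rewrite -YaZ; move: (a ** Z) => q; by rewrite !numulA.
rewrite !out !Su numulA uS -numulA Gu => /(congr1 (fun x => x ** S b)).
rewrite -numulA (KP_GS0 h ncb) numul0r -rb (KP_rS h) => /esym.
exact: Sneq0.
Qed.

End Sufficiency.

(** * Terminal vertices generate minimal right ideals *)

Section NoCycle.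
Variables (R : comPzRingType) (k : nat) (L : kgraph k).
Variables (A : nualg R) (S G : kpath L -> A).
Hypothesis h : is_KP_family S G.
Hypothesis terms : forall x : A, exists s : seq (R * (kpath L * kpath L)),
  x = \sum_(t <- s) t.1 *: (S t.2.1 ** G t.2.2).
Hypothesis Sneq0 : forall l, S l <> 0.
Implicit Types (v w u t : kvert L) (l mu nu a b c : kpath L) (x y z : A).

Notation Sv v := (S (kid L v)).

(** Cutting by s_t on both sides leaves only spanning terms whose two paths have range [t], and both
    are then the vertex path. *)
Lemma terminal_corner t x : terminal t -> exists r : R, Sv t ** x ** Sv t = r *: Sv t.
Proof.
move=> ht; have [s ->] := terms x; rewrite numul_sumr numul_suml.
apply: (big_ind (fun y => exists r : R, y = r *: Sv t)).
- by exists 0; rewrite scale0r.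
- by move=> _ _ [r ->] [r' ->]; exists (r + r'); rewrite scalerDl.
- move=> p _; rewrite numulZr numulZl numulA.
  have [ea|na] := pselect (krng p.2.1 = t); last first.
    exists 0; rewrite scale0r -(KP_rS h p.2.1) numulA (KP_vw h); last exact/nesym.
    by rewrite !numul0l scaler0.
  have [eb|nb] := pselect (krng p.2.2 = t); last first.
    exists 0; rewrite scale0r -(KP_Gr h p.2.2) -!numulA (KP_vw h)//.
    by rewrite !numul0r scaler0.
  exists p.1; rewrite (ht _ ea) (ht _ eb) (KP_ghost_id h).
  by rewrite !(KP_vv h).
Qed.

(** The [y] with [x A y] = 0 form an ideal that is not the whole algebra, hence is 0 and misses s_t.
    So some [x a] s_t is nonzero; it is a scalar multiple of s_t, and the scalar is invertible. *)
Lemma terminal_minimal t (N : set A) x : is_field R -> nusimple A -> terminal t ->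
  right_ideal N -> N x -> x <> 0 -> rprincipal (Sv t) x -> N (Sv t).
Proof.
move=> [_ hinv] [_ hs] ht [[N0 NB] hN] Nx nx [x' _ ex].
have xt : Sv t ** x = x by rewrite -ex numulA (KP_vv h).
have [a na] : exists a : A, x ** a ** Sv t <> 0.
  apply: contrapT => hno.
  pose J := [set y | forall a : A, x ** a ** y = 0].
  have hJ : two_sided_ideal J.
    split; first split; first split.
    - by move=> a; rewrite numul0r.
    - by move=> y z hy hz a; rewrite numulBr hy hz subrr.
    - by move=> y b hy a; rewrite numulA hy numul0l.
    - by move=> y b hy a; rewrite numulA -(numulA x) hy.
  have JS : J (Sv t) by move=> a; apply: contrapT => na; apply: hno; exists a.
  case: (hs _ hJ) => e; first by move: JS; rewrite e => /Sneq0.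
  have [v nv] := right_unit h terms nx.
  apply: nv; have : J (Sv v) by rewrite e.
  by move=> /(_ (Sv v)); rewrite -numulA (KP_vv h).
have [r er] := terminal_corner (x ** a) ht.
rewrite numulA xt in er.
have nr : r <> 0 by move=> r0; apply: na; rewrite er r0 scale0r.
have [s es] := hinv _ nr.
have -> : Sv t = x ** (a ** (s *: Sv t)).
  by rewrite !numulZr numulA er scalerA mulrC es scale1r.
exact: hN.
Qed.

Lemma needs_cycle : (exists v : kvert L, True) ->
  (forall v : kvert L, finite_set [set z | vle v z]) ->
  is_field R -> nusimple A -> purely_infinite A -> has_cycle L.
Proof.
move=> [v _] fin hR hs pinf; apply: contrapT => nc.
have [t _ ht0] := maximal_above v fin.
have ht : terminal t.
  move=> l rl; have [m [rm sm]] : vle (ksrc l) t by apply: ht0; exists l.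
  rewrite -rl; apply: deg0_id; apply: contrapT => dl; apply: nc.
  exists (kcomp l m); rewrite krng_comp// ksrc_comp// kdeg_comp//.
  split; last by rewrite sm.
  move=> /ffunP e; apply: dl; apply: degP => i.
  by have := e i; rewrite !degE; lia.
have nI : rprincipal (Sv t) <> [set 0].
  move=> e; have : rprincipal (Sv t) (Sv t) by exists (Sv t); rewrite ?(KP_vv h).
  by rewrite e => /Sneq0.
have [e [[e' _ Ie] [ee [M [[hM [neM [N [hN MN0 MN]]]] [f [[ff fi fs] fD fM]]]]]]] :=
  pinf _ (rprincipal_ideal _) nI.
have sub x : rprincipal e x -> rprincipal (Sv t) x.
  by move=> [y _ <-]; rewrite -Ie; exists (e' ** y); rewrite ?numulA.
have [[M0 _] _] := hM; have [[N0 _] _] := hN.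
have subM x : M x -> rprincipal e x.
  by move=> Mx; rewrite MN; exists x => //; exists 0; rewrite ?addr0.
have subN x : N x -> rprincipal e x.
  by move=> Nx; rewrite MN; exists 0 => //; exists x; rewrite ?add0r.
have nz (Q : set A) : Q 0 -> Q <> [set 0] -> exists2 x, Q x & x <> 0.
  move=> Q0 nQ; apply: contrapT => hno; apply: nQ.
  apply/seteqP; split=> [x Qx|_ -> //].
  by apply: contrapT => nx; apply: hno; exists x.
(* [N] is nonzero because [M] is a proper summand, and [M] because it is the injective image of
   [e A], which contains [x]. By minimality both contain s_t, although they meet in 0. *)
have [x Nx nx] : exists2 x, N x & x <> 0.
  apply: nz => // N00; apply: neM; apply/seteqP; split=> y; first exact: subM.
  by rewrite MN N00 => -[m Mm [_ -> <-]]; rewrite addr0.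
have [y My ny] : exists2 y, M y & y <> 0.
  apply: nz => // M00; apply: nx.
  have f0 z : rprincipal e z -> f z = 0 by move=> /ff; rewrite M00.
  have e0 : rprincipal e 0 by exists 0; rewrite ?numul0r.
  apply: (fi x 0 (mem_set (subN _ Nx)) (mem_set e0)).
  by rewrite (f0 x (subN _ Nx)) (f0 0 e0).
have tN := terminal_minimal hR hs ht hN Nx nx (sub _ (subN _ Nx)).
have tM := terminal_minimal hR hs ht hM My ny (sub _ (subM _ My)).
have : (M `&` N) (Sv t) by [].
by rewrite MN0 => /Sneq0.
Qed.

End NoCycle.

Theorem theorem6p3 (R : comPzRingType) (k : nat) (hk : (0 < k)%N)
    (L : kgraph k) (fa : finitely_aligned L)
    (fin_above : forall v : kvert L, finite_set [set w | vle v w]) :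
  purely_infinite_simple (KP R L) <->
  [/\ is_field R, cofinal L, aperiodic L & has_cycle L].
Proof.
have hf := kp_family R fa; have ht := kp_terms fa.
split=> [[pinf hs]|[hR cof ap cyc]].
  have hR := simple_field fa hs.
  split=> //; [exact: simple_cofinal hs|exact: simple_aperiodic hs|].
  apply: (needs_cycle hf (ht R)) => //; last exact: simple_vertex hs.
  by move=> l; exact: kps_neq01.
have nz l : (kps R l : KP R L) <> 0.
  by case: hR => n1 _; have := kps_neq0 fa (l := l) n1; rewrite scale1r.
split; first exact: (sufficient_infinite fa hf (ht R) nz).
(* The cycle supplies the vertex that makes the algebra nonzero. *)
have [mu _] := cyc.
exact: (sufficient_simple fa hf (ht R) nz (krng mu)).
Qed.
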